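(* Every minimally $3$-matchable graph is isomorphic to the disjoint union of any number (possibly zero) of copies of $K_2$ and either (i) two disjoint $2$-cycles, or (ii) an odd subdivision of the theta graph, or (iii) an odd subdivision of $K_4$.
   Context: All graphs are finite and undirected; they may have multiple (parallel) edges but no loops. A $2$-cycle is the graph on two vertices joined by two parallel edges. The theta graph is the graph on two vertices joined by three parallel edges. A perfect matching of a graph $G$ is a set of edges such that every vertex is an end vertex of exactly one of them; $\mathfrak{M}(G)$ denotes the set of perfect matchings of $G$. A graph $G$ is $k$-matchable if $|\mathfrak{M}(G)| \geq k$, and minimally $k$-matchable if it is $k$-matchable but $G-e$ is not $k$-matchable for every edge $e$ of $G$. An odd subdivision of a graph $H$ is any graph obtained from $H$ by replacing every edge $e$ by a path of odd length (possibly $1$) connecting the end vertices of $e$, such that all these paths are pairwise internally disjoint; in particular $H$ is an odd subdivision of itself.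
   Formalization: Case (i) is proved as ''an odd subdivision of two disjoint 2-cycles'' (two disjoint even cycles): with literal 2-cycles the claim fails, since two disjoint 4-cycles form a minimally 3-matchable graph fitting none of (i)–(iii). *)

(* Defs.v *)
From mathcomp Require Import all_boot.
Set Implicit Arguments.
Unset Strict Implicit.
Unset Printing Implicit Defensive.

(* Finite undirected multigraphs: parallel edges are distinct elements of
   [edge] with the same set of ends; loops are excluded by [card_ends]. *)
Record mgraph := MGraph {
  vertex : finType;
  edge : finType;
  ends : edge -> {set vertex};
  card_ends : forall e, #|ends e| = 2
}.

Definition isomorphic (G H : mgraph) : Prop :=
  exists (f : vertex G -> vertex H) (g : edge G -> edge H),
    [/\ bijective f, bijective g & forall e, ends (g e) = f @: ends e].

Definition del_edge (G : mgraph) (e : edge G) : mgraph :=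
  @MGraph (vertex G) {f : edge G | f != e} (fun f => ends (val f))
    (fun f => card_ends (val f)).

Definition dunion_ends (G H : mgraph) (e : edge G + edge H) :
    {set vertex G + vertex H} :=
  match e with
  | inl e1 => inl @: ends e1
  | inr e2 => inr @: ends e2
  end.

Lemma card_dunion_ends (G H : mgraph) (e : edge G + edge H) :
  #|dunion_ends e| = 2.
Proof.
by case: e => e /=; rewrite card_imset ?card_ends // => x y [].
Qed.

Definition dunion (G H : mgraph) : mgraph := MGraph (@card_dunion_ends G H).

Definition copies_ends (n : nat) (G : mgraph) (e : 'I_n * edge G) :
    {set 'I_n * vertex G} := pair e.1 @: ends e.2.

Lemma card_copies_ends (n : nat) (G : mgraph) (e : 'I_n * edge G) :
  #|copies_ends e| = 2.
Proof. by rewrite card_imset ?card_ends // => x y []. Qed.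

Definition copies (n : nat) (G : mgraph) : mgraph :=
  MGraph (@card_copies_ends n G).

Lemma card_complete_ends (n : nat) (e : {A : {set 'I_n} | #|A| == 2}) :
  #|val e| = 2.
Proof. exact/eqP/(valP e). Qed.

Definition complete (n : nat) : mgraph := MGraph (@card_complete_ends n).

Lemma card_dipole_ends (k : nat) (e : 'I_k) : #|[set: 'I_2]| = 2.
Proof. by rewrite cardsT card_ord. Qed.

(* Two vertices joined by [k] parallel edges. *)
Definition dipole (k : nat) : mgraph := MGraph (@card_dipole_ends k).

Definition K2 : mgraph := complete 2.
Definition K4 : mgraph := complete 4.
Definition two_cycle : mgraph := dipole 2.
Definition theta : mgraph := dipole 3.

Definition perfect_matching (G : mgraph) (M : {set edge G}) : bool :=
  [forall v, #|[set e in M | v \in ends e]| == 1].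

Definition perfect_matchings (G : mgraph) : {set {set edge G}} :=
  [set M | perfect_matching M].

Definition matchable (k : nat) (G : mgraph) : Prop :=
  k <= #|perfect_matchings G|.

Definition minimally_matchable (k : nat) (G : mgraph) : Prop :=
  matchable k G /\ forall e : edge G, ~ matchable k (del_edge e).

(* A walk starting at [x] is given by the sequence
   [:: (e_1, x_1); ...; (e_l, x_l)] of its edges, each paired with the vertex
   it leads to; its length is the size [l] of that sequence. *)
Fixpoint is_walk (G : mgraph) (x : vertex G)
    (p : seq (edge G * vertex G)) : bool :=
  if p is (e, y) :: p' then (ends e == [set x; y]) && is_walk y p' else true.

Definition is_path (G : mgraph) (x : vertex G)
    (p : seq (edge G * vertex G)) : bool :=
  is_walk x p && uniq (x :: unzip2 p).

Definition path_end (G : mgraph) (x : vertex G)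
    (p : seq (edge G * vertex G)) : vertex G := last x (unzip2 p).

Definition path_inner (G : mgraph) (x : vertex G)
    (p : seq (edge G * vertex G)) : seq (vertex G) :=
  behead (belast x (unzip2 p)).

(* [S] is obtained from [H] by replacing each edge [e] by the path that starts
   at [s e] and follows [p e]; [phi] places the vertices of [H] in [S].
   Edge-disjointness has to be required separately: internal disjointness does
   not force it for two paths of length 1 replacing parallel edges. *)
Definition odd_subdivision (H S : mgraph) : Prop :=
  exists (phi : vertex H -> vertex S) (s : edge H -> vertex S)
         (p : edge H -> seq (edge S * vertex S)),
    [/\ injective phi,
        forall e, [/\ is_path (s e) (p e), odd (size (p e)) &
                      [set s e; path_end (s e) (p e)] = phi @: ends e],
        [/\ forall e v, phi v \notin path_inner (s e) (p e),
            forall e f, e != f ->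
              ~~ has (mem (path_inner (s e) (p e))) (path_inner (s f) (p f)) &
            forall e f, e != f ->
              ~~ has (mem (unzip1 (p e))) (unzip1 (p f))],
        forall x : vertex S, (exists v, x = phi v) \/
                             (exists e, x \in path_inner (s e) (p e)) &
        forall d : edge S, exists e, d \in unzip1 (p e)].

(* Main.v *)
Require Import Defs.
From mathcomp Require Import all_boot zify.
Set Implicit Arguments.
Unset Strict Implicit.
Unset Printing Implicit Defensive.

(** By minimality, any three distinct perfect matchings cover all edges.  If two
    of them differ on two separate alternating cycles, these cycles yield three
    matchings by themselves, and the graph is their union with copies of K2.
    Otherwise fix three matchings M_0, M_1, M_2 and let T be the set of vertices
    of degree 3.  From a vertex of T, an M_i-edge starts a "thread" that
    alternates between M_i and the other two matchings and ends in T, again with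
    an M_i-edge; so G is, up to K2's, an odd subdivision of a 3-edge-coloured
    cubic graph on T with colour involutions tau_0, tau_1, tau_2.  A colouring c
    of T by colours is consistent if c (tau_(c t) t) = c t; it lifts to a perfect
    matching of G, and minimality forces c to be constant.  Hence colours 0 and 1
    form a Hamiltonian cycle of T.  If #|T| > 4, the chords of colour 2 join
    vertices of equal parity on this cycle, an innermost chord is crossed by
    another one of opposite parity, and two such crossing chords define a
    non-constant consistent colouring.  So #|T| is 2 (theta) or 4 (K4). *)

(** * Alternating sequences of two involutions *)

Section AlternatingPath.
Variables (V : finType) (m n : V -> V) (D : {set V}) (t : V).
Hypotheses (mK : involutive m) (m_neq : forall v, m v != v).
Hypotheses (nK : {in D, involutive n}) (n_neq : {in D, forall v, n v != v}).
Hypotheses (nD : {in D, forall v, n v \in D}) (tD : t \notin D).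

Fixpoint altpos (i : nat) : V :=
  if i is j.+1 then (if odd j then n else m) (altpos j) else t.

(** Loop invariant after [k] rounds of one [m]-step and one [n]-step. Only even last positions are
    considered, because the walk can leave [D] only by an [m]-step. *)
Let good k := (forall i, 0 < i <= k.*2 -> altpos i \in D) /\
  (forall i j, i <= k.*2 -> j <= k.*2 -> altpos i = altpos j -> i = j).

Lemma altpos_even i : ~~ odd i -> altpos i.+1 = m (altpos i).
Proof. by rewrite /= => /negbTE ->. Qed.

Lemma altpos_odd i : odd i -> altpos i.+1 = n (altpos i).
Proof. by rewrite /= => ->. Qed.

(** Applying [m] to a coincidence sends position [i] to its [m]-neighbour [i.-1] or [i.+1] and the
    new position back to [k.*2]. Injectivity so far then contradicts the range of [i] or its parity;
    [i = k.*2] would be a fixed point of [m]. *)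
Lemma altpos_new k : good k ->
  forall i, i <= k.*2 -> altpos i <> altpos k.*2.+1.
Proof.
move=> [kD kI] i ik; rewrite altpos_even ?odd_double //.
case: (eqVneq i k.*2) => [->|ne] E.
  by move: (m_neq (altpos k.*2)); rewrite -E eqxx.
have /(congr1 m) := E; rewrite mK.
case: (boolP (odd i)) => oi.
  have i0 : 0 < i by case: (i) oi.
  have oi' : ~~ odd i.-1 by case: (i) oi.
  rewrite -(prednK i0) altpos_even // mK => /kI; lia.
rewrite -altpos_even // => /kI; lia.
Qed.

(** As long as the walk stays in [D] it never repeats a vertex, so by finiteness it leaves [D]. It
    does so after an [m]-step, since [n] preserves [D]; hence the number [L] of vertices is even. *)
Lemma alternating_path : exists L : nat,
  [/\ ~~ odd L, 1 < L,
      forall i j, i < L -> j < L -> altpos i = altpos j -> i = j,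
      forall i, 0 < i < L.-1 -> altpos i \in D & altpos L.-1 \notin D].
Proof.
have step k : good k -> altpos k.*2.+1 \in D -> good k.+1.
  move=> gk uD; have := altpos_new gk; case: gk => kD kI new.
  have ok : odd k.*2.+1 by rewrite /= odd_double.
  have wE := altpos_odd ok.
  have wD : altpos k.*2.+2 \in D by rewrite wE nD.
  (* The reflection argument of [altpos_new], now with [n]. Position 0 is treated apart because [n]
     is only known to be an involution on [D]. *)
  have new2 i : i <= k.*2 -> altpos i <> altpos k.*2.+2.
    move=> ik E; case: (posnP i) => [i0|i0].
      by move: wD; rewrite -E i0 /= (negbTE tD).
    have iD : altpos i \in D by apply: kD; rewrite i0.
    have := E; rewrite wE => /(congr1 n); rewrite nK //.
    case: (boolP (odd i)) => oi.
      rewrite -altpos_odd // => /new; apply.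
      by have := odd_double k; have := ik; lia.
    have oi' : odd i.-1 by case: (i) i0 oi => //= ? _ /negbNE.
    rewrite -(prednK i0) altpos_odd // nK; last first.
      by apply: kD; have := oi'; lia.
    by move=> /new; apply; lia.
  have new3 : altpos k.*2.+1 <> altpos k.*2.+2.
    by rewrite wE => E; move: (n_neq uD); rewrite -E eqxx.
  split=> [i|i j]; rewrite doubleS => /= hi.
    case: (ltngtP i k.*2.+1) => [h|h|->] //; first by apply: kD; lia.
    by have -> : i = k.*2.+2 by lia.
  move=> hj.
  have ci : [\/ i <= k.*2, i = k.*2.+1 | i = k.*2.+2].
    by case: (ltngtP i k.*2.+1) => h; [constructor 1|constructor 3|constructor 2]; lia.
  have cj : [\/ j <= k.*2, j = k.*2.+1 | j = k.*2.+2].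
    by case: (ltngtP j k.*2.+1) => h; [constructor 1|constructor 3|constructor 2]; lia.
  case: ci => [hi'|->|->]; case: cj => [hj'|->|->] //.
  - exact: kI.
  - by move/new.
  - by move/new2.
  - by move/esym/new.
  - by move/esym/new2.
  - by move/esym.
have good0 : good 0.
  by split=> [i|i j]; rewrite double0; [case: (i) | case: i; case: j].
have bound k : good k -> k < #|V|.
  move=> [_ kI].
  have inj : injective (fun i : 'I_(k.*2.+1) => altpos i).
    by move=> i j /kI E; apply/val_inj/E; rewrite -ltnS.
  have := leq_card _ inj; rewrite card_ord; lia.
have [k gk uD] : exists2 k, good k & altpos k.*2.+1 \notin D.
  (* The fuel [f] bounds the number of rounds left, as [bound] keeps [k] below [#|V|]. *)
  have H : forall f k, #|V| - k <= f -> good k ->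
      exists2 k, good k & altpos k.*2.+1 \notin D.
    elim=> [|f IH] k hf gk; first by have := bound _ gk; lia.
    case: (boolP (altpos k.*2.+1 \in D)) => h; last by exists k.
    by apply: (IH k.+1) (step _ gk h); have := bound _ gk; lia.
  exact: (H _ 0 (leqnn _) good0).
have new := altpos_new gk; case: gk => kD kI.
exists k.*2.+2; split=> //=.
- by rewrite negbK odd_double.
- move=> i j hi hj.
  case: (ltngtP i k.*2.+1) => [h|h|->]; [|lia|];
  case: (ltngtP j k.*2.+1) => [h'|h'|->]; try lia.
  + exact: kI.
  + by move/new => /(_ _); case; lia.
  + by move/esym/new => /(_ _); case; lia.
Qed.

End AlternatingPath.

(** * Three involutions without non-constant consistent colourings *)

Section CyclicPositions.
Variables (L : nat) (chord : nat -> nat).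
Hypotheses (L_even : ~~ odd L) (L_gt4 : 4 < L).
Hypotheses (chord_lt : forall q, q < L -> chord q < L)
  (chordK : forall q, q < L -> chord (chord q) = q)
  (chord_neq : forall q, q < L -> chord q <> q).

(* Positions [0, ..., L-1] lie on a cycle whose edges are alternately of
   colours 0 (from an even position to its successor) and 1. *)
Definition cyc0 (q : nat) := if odd q then q.-1 else q.+1.
Definition cyc1 (q : nat) :=
  if odd q then (if q.+1 == L then 0 else q.+1)
  else (if q == 0 then L.-1 else q.-1).

(** The consistency condition read on the positions of the cycle, with [chord] as the involution of
    colour 2. *)
Definition position_coloring (g : nat -> nat) := forall q, q < L ->
  [\/ g q = 0 /\ g (cyc0 q) = 0, g q = 1 /\ g (cyc1 q) = 1 |
      g q = 2 /\ g (chord q) = 2].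

Hypothesis coloring_const : forall g, position_coloring g ->
  forall q r, q < L -> r < L -> g q = g r.

(** Strictly between two positions of opposite parity there are evenly many, and they fall into
    pairs of neighbours of one colour: the one that does not join [lo] to [lo.+1]. The positions
    outside pair up in the other colour, see [cyc_outside]. *)
Lemma cyc_between lo hi q : lo < q < hi -> hi < L -> odd hi = ~~ odd lo ->
  lo < (if odd lo then cyc0 else cyc1) q < hi.
Proof.
move=> qlh hL olh; case: ifP => olo; rewrite /cyc0 /cyc1.
  by case: ifP => oq; lia.
by case: ifP => oq; case: ifP; lia.
Qed.

Lemma cyc_outside lo hi q : lo < hi -> hi < L -> odd hi = ~~ odd lo ->
  q < L -> (q < lo) || (hi < q) ->
  let r := (if odd lo then cyc1 else cyc0) q in (r < lo) || (hi < r).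
Proof.
move=> lh hL olh qL qout; case: ifP => olo; rewrite /= /cyc0 /cyc1.
  by case: ifP => oq; case: ifP; lia.
by case: ifP => oq; lia.
Qed.

Lemma position_case (g : nat -> nat) q (b : bool) : g q = b ->
  g ((if b then cyc1 else cyc0) q) = b ->
  [\/ g q = 0 /\ g (cyc0 q) = 0, g q = 1 /\ g (cyc1 q) = 1 |
      g q = 2 /\ g (chord q) = 2].
Proof. by case: b => E E'; [constructor 2 | constructor 1]. Qed.

(** If the ends had opposite parity, colour 2 on the chord, one of the colours 0 and 1 on the arc
    inside and the other one outside would be a consistent colouring. *)
Lemma chord_parity p0 p1 : p0 < p1 -> p1 < L -> chord p0 = p1 ->
  odd p0 = odd p1.
Proof.
move=> lt01 ltL c01.
have c10 : chord p1 = p0 by rewrite -c01 chordK //; lia.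
case: (boolP (odd p0 == odd p1)) => [/eqP //|np].
have {}np : odd p1 = ~~ odd p0 by move: np; do 2 case: odd.
pose g q : nat := if (q == p0) || (q == p1) then 2 else
  if (p0 < q < p1) then ~~ odd p0 else odd p0.
have gin r : p0 < r < p1 -> g r = ~~ odd p0.
  by move=> h; rewrite /g h ifF //; lia.
have gout r : (r < p0) || (p1 < r) -> g r = odd p0.
  by move=> h; rewrite /g !ifF //; lia.
have col : position_coloring g.
  move=> q qL.
  case: (eqVneq q p0) => [->|n0].
    by constructor 3; rewrite c01 /g !eqxx /= orbT.
  case: (eqVneq q p1) => [->|n1].
    by constructor 3; rewrite c10 /g !eqxx /= orbT.
  have [h|h] : p0 < q < p1 \/ (q < p0) || (p1 < q) by lia.
    apply: (position_case (gin _ h)); rewrite if_neg gin //.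
    exact: cyc_between.
  by apply: (position_case (gout _ h)); rewrite gout //; exact: cyc_outside.
(* A third position has colour 0 or 1, so [g] is not constant. *)
have [r rL rn] : exists2 r, r < L & (r != p0) && (r != p1).
  by case: (boolP ((0 != p0) && (0 != p1))) => h0; [exists 0|
    case: (boolP ((1 != p0) && (1 != p1))) => h1; [exists 1|exists 2]]; lia.
have := @coloring_const g col r p0 rL (ltn_trans lt01 ltL).
by move: rn; rewrite /g eqxx => /andP[/negbTE -> /negbTE ->] /=;
  case: ifP; case: odd.
Qed.

(** By [chord_parity], crossing chords of different parity cut the cycle into four arcs, each with
    ends of opposite parity. With colour 2 on the chords, the arcs can be coloured alternately by 0
    and 1. *)
Lemma no_crossing p0 p1 p2 p3 : p0 < p1 -> p1 < p2 -> p2 < p3 -> p3 < L ->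
  chord p0 = p2 -> chord p1 = p3 -> odd p0 = odd p1.
Proof.
move=> lt01 lt12 lt23 ltL c02 c13.
have c20 : chord p2 = p0 by rewrite -c02 chordK //; lia.
have c31 : chord p3 = p1 by rewrite -c13 chordK //; lia.
have o02 : odd p0 = odd p2 by apply: chord_parity => //; lia.
have o13 : odd p1 = odd p3 by apply: chord_parity => //; lia.
case: (boolP (odd p0 == odd p1)) => [/eqP //|np].
have {}np : odd p1 = ~~ odd p0 by move: np; do 2 case: odd.
pose g q : nat := if [|| q == p0, q == p1, q == p2 | q == p3] then 2 else
  if (p0 < q < p1) || (p2 < q < p3) then ~~ odd p0 else odd p0.
have gb r : (p0 < r < p1) || (p2 < r < p3) -> g r = ~~ odd p0.
  by move=> h; rewrite /g h ifF //; lia.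
have ga r : [|| p1 < r < p2, r < p0 | p3 < r] -> g r = odd p0.
  by move=> h; rewrite /g !ifF //; lia.
have col : position_coloring g.
  move=> q qL.
  case: (boolP [|| q == p0, q == p1, q == p2 | q == p3]) => hq.
    constructor 3; split; first by rewrite /g hq.
    by case/or4P: hq => /eqP ->; rewrite ?c02 ?c13 ?c20 ?c31 /g !eqxx ?orbT.
  have [h|h] : (p0 < q < p1) || (p2 < q < p3) \/
               [|| p1 < q < p2, q < p0 | p3 < q] by lia.
    apply: (position_case (gb _ h)); rewrite if_neg gb //.
    case/orP: h => h; first by rewrite cyc_between //; lia.
    by rewrite o02 orbC cyc_between // -o13 -o02.
  apply: (position_case (ga _ h)); rewrite ga //.
  case/orP: h => h.
    have := @cyc_between p1 p2 q h (ltn_trans lt23 ltL).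
    by rewrite np -o02 negbK if_neg => -> //.
  have := @cyc_outside p0 p3 q _ ltL _ qL h; rewrite -o13 np => /= -> //.
    by rewrite orbT.
  lia.
have [r rL rn] : exists2 r, r < L & ~~ [|| r == p0, r == p1, r == p2 | r == p3].
  case: (boolP (0 == p0)) => h0; last by exists 0; lia.
  case: (boolP (1 == p1)) => h1; last by exists 1; lia.
  case: (boolP (2 == p2)) => h2; last by exists 2; lia.
  by case: (boolP (3 == p3)) => h3; [exists 4|exists 3]; lia.
have p0L : p0 < L by lia.
have := @coloring_const g col r p0 rL p0L.
by move: rn; rewrite /g eqxx => /negbTE -> /=; case: ifP; case: odd.
Qed.

(** Descent on chord lengths. The chord at [q.+1] has the parity opposite to that of the chord at
    [q], so by [no_crossing] it cannot leave the interval spanned by the latter. It therefore lies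
    inside and is strictly shorter. *)
Lemma position_contradiction : False.
Proof.
(* Subtraction being truncated, this sum is the absolute difference. *)
pose len q := (chord q - q) + (q - chord q).
have H : forall k q, q < L -> q < chord q -> len q <= k -> False.
  elim=> [|k IH] q qL lt; first by rewrite /len; lia.
  move=> lenk.
  have cL := chord_lt qL.
  have oq := chord_parity lt cL erefl.
  have rL : q.+1 < L by lia.
  have sL := chord_lt rL; have sK := chordK rL; have sn := chord_neq rL.
  have qK := chordK qL.
  set s := chord q.+1 in sL sK sn *.
  have os : odd q.+1 = odd s.
    case: (ltngtP q.+1 s) => h; last 1 first.
    - by case: sn.
    - exact: chord_parity.
    - by apply/esym/(chord_parity h).
  case: (ltnP s q) => [sq|qs].
    have : odd s = odd q.
      by apply: (@no_crossing s q q.+1 (chord q)); rewrite // /s; lia.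
    by move: os => /=; lia.
  have sq : s <> q by move=> E; move: os; rewrite E /=; lia.
  have sq1 : q.+1 < s by lia.
  case: (ltnP (chord q) s) => [sb|sb].
    have : odd q = odd q.+1.
      by apply: (@no_crossing q q.+1 (chord q) s) => //; lia.
    by rewrite /=; lia.
  have : s <> chord q by move=> E; move: os; rewrite E -oq /=; lia.
  move=> sne; apply: (IH q.+1) => //; rewrite /len -/s; move: lenk; rewrite /len.
  lia.
have L0 : 0 < L by lia.
apply: (H (len 0) 0) => //.
have := chord_neq L0; lia.
Qed.

End CyclicPositions.

(** * From three involutions to chords of a Hamiltonian cycle *)

Section ThreeInvolutions.
Variables (T : finType) (tau : 'I_3 -> T -> T).
Hypotheses (tauK : forall i, involutive (tau i))
  (tau_neq : forall i t, tau i t != t).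
Hypothesis coloring_const : forall c : T -> 'I_3,
  (forall t, c (tau (c t) t) = c t) -> forall t u, c t = c u.

(** Colour [Y] by [i] and its complement, which is closed under [tau j] as well, by [j]. This
    colouring is consistent, hence constant. *)
Lemma tau_orbit_full (i j : 'I_3) (Y : pred T) (t : T) : i != j -> Y t ->
  (forall u, Y u -> Y (tau i u)) -> (forall u, Y u -> Y (tau j u)) ->
  forall u, Y u.
Proof.
move=> ij Yt Yi Yj u.
have := @coloring_const (fun v => if Y v then i else j) _ t u.
rewrite Yt; case: ifP => // _ H.
suff /H/eqP : forall v, (if Y (tau (if Y v then i else j) v) then i else j) =
  (if Y v then i else j) by rewrite (negbTE ij).
move=> v; case: (boolP (Y v)) => h; first by rewrite Yi.
case: ifP => // h'; case/negP: h; rewrite -(tauK j v); exact: Yj.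
Qed.

(** By [tau_orbit_full], the alternating path of colours 0 and 1 from [t0], closed up by colour 1,
    visits all of [T]; then [tau i2] gives chords, and [position_contradiction] excludes more than
    four vertices. If there are four, [tau i t = tau j t] would make the pair of [t] and [tau i t]
    closed under both involutions and hence all of [T]. *)
Lemma card_three_involutions (t0 : T) :
  #|T| = 2 \/ (#|T| = 4 /\ forall t, injective (tau^~ t)).
Proof.
pose i0 : 'I_3 := inord 0; pose i1 : 'I_3 := inord 1; pose i2 : 'I_3 := inord 2.
have v0 : val i0 = 0 by rewrite /= inordK.
have v1 : val i1 = 1 by rewrite /= inordK.
have v2 : val i2 = 2 by rewrite /= inordK.
pose D : {set T} := ~: [set t0; tau i1 t0].
have inD v : (v \in D) = (v != t0) && (v != tau i1 t0).
  by rewrite !inE negb_or.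
have nD : {in D, forall v, tau i1 v \in D}.
  move=> v; rewrite !inD => /andP[a b]; apply/andP; split.
    by apply: contraNneq b => <-; rewrite tauK.
  by rewrite (can_eq (@tauK i1)).
have tD : t0 \notin D by rewrite inD eqxx.
have [L [Lev L1 xI xD xL]] := @alternating_path T (tau i0) (tau i1) D t0
  (@tauK i0) (@tau_neq i0) (fun v _ => @tauK i1 v) (fun v _ => @tau_neq i1 v) nD tD.
set x := altpos _ _ _ in xI xD xL.
have xlast : x L.-1 = tau i1 t0.
  move: xL; rewrite inD negb_and !negbK => /orP[]/eqP // E.
  by have := xI L.-1 0 _ _ E; lia.
have x_0 q : q < L -> tau i0 (x q) = x (cyc0 q).
  move=> qL; rewrite /cyc0; case: ifP => oq.
    have -> : q = q.-1.+1 by case: (q) oq.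
    by rewrite /x [altpos _ _ _ q.-1.+1]altpos_even ?tauK //; lia.
  by rewrite /x altpos_even // oq.
have cyc0L q : q < L -> cyc0 q < L by rewrite /cyc0; case: ifP; lia.
have x_1 q : q < L -> tau i1 (x q) = x (cyc1 L q).
  move=> qL; rewrite /cyc1; case: ifP => oq.
    case: eqP => qE; last by rewrite /x altpos_odd.
    have -> : q = L.-1 by lia.
    by rewrite xlast tauK.
  case: eqP => [->|q0]; first by rewrite xlast.
  have -> : q = q.-1.+1 by lia.
  by rewrite /x [altpos _ _ _ q.-1.+1]altpos_odd ?tauK //; lia.
have cyc1L q : q < L -> cyc1 L q < L by rewrite /cyc1; repeat case: ifP; intros; lia.
have xsurj t : exists q : 'I_L, x q = t.
  have : [exists q : 'I_L, x q == t].
    apply: (@tau_orbit_full i0 i1 (fun t => [exists q : 'I_L, x q == t]) t0).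
    - by rewrite -val_eqE v0 v1.
    - by apply/existsP; exists (Ordinal (ltnW L1)).
    - move=> u /existsP[q /eqP <-]; apply/existsP.
      by exists (Ordinal (cyc0L q (ltn_ord q))); rewrite x_0.
    - move=> u /existsP[q /eqP <-]; apply/existsP.
      by exists (Ordinal (cyc1L q (ltn_ord q))); rewrite x_1.
  by case/existsP=> q /eqP; exists q.
have [pos posK] := fin_all_exists xsurj.
have cT : #|T| = L.
  rewrite -(card_ord L); apply: (@bij_eq_card _ _ pos).
  exists (fun q : 'I_L => x q) => [t|q]; first exact: posK.
  by apply: ord_inj; apply: xI => //; apply: posK.
case: (ltnP 4 L) => L4.
  pose chord q : nat := pos (tau i2 (x q)).
  exfalso; apply: (@position_contradiction L chord) => //.
  - by move=> q qL; rewrite /chord.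
  - by move=> q qL; apply: xI => //; rewrite /chord ?posK ?tauK.
  - by move=> q qL E; have := tau_neq i2 (x q); rewrite -{2}E /chord posK eqxx.
  move=> g gP q r qL rL.
  have gL s : s < L -> g s < 3 by move=> /gP[] [-> _].
  pose c t : 'I_3 := inord (g (pos t)).
  have cE s : s < L -> c (x s) = inord (g s).
    by move=> sL; rewrite /c (xI (pos (x s)) s) //; apply: posK.
  have := @coloring_const c _ (x q) (x r).
  rewrite !cE // => H.
  suff /H/(congr1 val) : forall t, c (tau (c t) t) = c t by rewrite /= !inordK ?gL.
  move=> t; have [s ->] : exists s : 'I_L, t = x s by exists (pos t).
  have sL := ltn_ord s.
  rewrite cE //; case: (gP _ sL) => [[-> E]|[-> E]|[-> E]].
  - by rewrite -/i0 x_0 // cE ?cyc0L // E.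
  - by rewrite -/i1 x_1 // cE ?cyc1L // E.
  - by rewrite -/i2 /c [g _]E.
have : L = 2 \/ L = 4 by lia.
case=> LE; rewrite cT LE; [by left|right; split=> // t i j E].
apply/eqP; apply: contraT => ij.
have all2 u : (u == t) || (u == tau i t).
  apply: (@tau_orbit_full i j (fun u => (u == t) || (u == tau i t)) t) => //.
  - by rewrite eqxx.
  - by move=> v /orP[]/eqP->; rewrite ?tauK eqxx ?orbT.
  - by move=> v /orP[]/eqP->; rewrite E ?tauK eqxx ?orbT.
have : #|T| <= #|[set t; tau i t]|.
  by rewrite -cardsT; apply: subset_leq_card; apply/subsetP=> u _; rewrite !inE.
by rewrite cards2 cT LE; case: (_ != _).
Qed.

End ThreeInvolutions.

(** * Perfect matchings as functions *)

Section OtherEnd.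
Variable G : mgraph.
Implicit Types (e : edge G) (v w : vertex G).

(** The default [v] is never returned, since an edge has two ends. *)
Definition other e v : vertex G := odflt v [pick w in ends e :\ v].

Lemma other_spec e v : v \in ends e ->
  ends e = [set v; other e v] /\ other e v != v.
Proof.
move=> ve; rewrite /other; case: pickP => [w|none] /=.
  rewrite !inE => /andP[wv we]; split=> //; apply/esym/eqP.
  rewrite eqEcard cards2 eq_sym wv card_ends leqnn andbT.
  by apply/subsetP=> u; rewrite !inE => /orP[]/eqP->.
have := card_ends e; rewrite (cardsD1 v) ve.
suff -> : ends e :\ v = set0 by rewrite cards0.
by apply/setP=> u; rewrite in_set0; exact: none.
Qed.

Lemma ends_other e v : v \in ends e -> ends e = [set v; other e v].
Proof. by case/other_spec. Qed.

Lemma other_neq e v : v \in ends e -> other e v != v.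
Proof. by case/other_spec. Qed.

Lemma other_ends e v : v \in ends e -> other e v \in ends e.
Proof. by move=> ve; rewrite (ends_other ve) !inE eqxx orbT. Qed.

Lemma mem_ends e v w : v \in ends e -> w \in ends e -> w = v \/ w = other e v.
Proof. by move/ends_other => ->; rewrite !inE => /orP[]/eqP; auto. Qed.

Lemma otherK e v : v \in ends e -> other e (other e v) = v.
Proof.
move=> ve; have oe := other_ends ve.
case: (mem_ends oe ve) => // E.
by have := other_neq ve; rewrite -E eqxx.
Qed.

End OtherEnd.

(* A perfect matching is encoded by the function sending each vertex to the
   matching edge covering it. *)
Definition matching_fun (G : mgraph) (F : vertex G -> edge G) : Prop :=
  (forall v, v \in ends (F v)) /\ (forall v, F (other (F v) v) = F v).

Definition mate (G : mgraph) (F : vertex G -> edge G) (v : vertex G) :=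
  other (F v) v.

Section MatchingFun.
Variables (G : mgraph) (F : vertex G -> edge G).
Hypothesis mF : matching_fun F.

Lemma matching_ends v : v \in ends (F v). Proof. by case: mF. Qed.
Hint Resolve matching_ends : core.

Lemma matching_mate v : F (mate F v) = F v. Proof. exact: (proj2 mF v). Qed.

Lemma mate_neq v : mate F v != v. Proof. exact: (other_neq (matching_ends v)). Qed.

Lemma mateK : involutive (mate F).
Proof. by move=> v; rewrite /mate matching_mate otherK. Qed.

Lemma ends_matching v : ends (F v) = [set v; mate F v].
Proof. exact: ends_other. Qed.

Lemma matching_eq v w : w \in ends (F v) -> F w = F v.
Proof.
by case/(mem_ends (matching_ends v)) => -> //; rewrite matching_mate.
Qed.

Lemma matching_perfect : perfect_matching [set F v | v in vertex G].
Proof.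
apply/forallP=> v; apply/cards1P; exists (F v); apply/setP=> e.
rewrite !inE; apply/andP/eqP => [[/imsetP[w _ ->] vw]|->].
  by rewrite (matching_eq vw).
by rewrite matching_ends imset_f.
Qed.

End MatchingFun.

Lemma perfect_matching_fun (G : mgraph) (M : {set edge G}) :
  perfect_matching M ->
  exists2 F, matching_fun F & M = [set F v | v in vertex G].
Proof.
move/forallP=> pM.
have uniqM v : exists e, [set e in M | v \in ends e] = [set e].
  by apply/cards1P; exact: pM.
have [F FE] := fin_all_exists uniqM.
have FM v : (F v \in M) && (v \in ends (F v)).
  by have := set11 (F v); rewrite -FE inE.
have FU v e : e \in M -> v \in ends e -> e = F v.
  by move=> eM ve; apply/set1P; rewrite -FE inE eM.
exists F.
  split=> v; first by case/andP: (FM v).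
  by case/andP: (FM v) => eM ve; apply/esym/FU => //; exact: other_ends.
apply/setP=> e; apply/idP/imsetP => [eM|[v _ ->]]; last by case/andP: (FM v).
have /card_gt0P[v ve] : 0 < #|ends e| by rewrite card_ends.
by exists v => //; exact: FU.
Qed.

Lemma matching_fun_inj (G : mgraph) (F F' : vertex G -> edge G) :
  matching_fun F -> matching_fun F' ->
  [set F v | v in vertex G] = [set F' v | v in vertex G] -> F =1 F'.
Proof.
move=> mF mF' E v.
have : F v \in [set F' v | v in vertex G] by rewrite -E imset_f.
case/imsetP=> w _ Fw; rewrite Fw; apply/esym/matching_eq => //.
by rewrite -Fw; case: mF.
Qed.

Definition matching_triple (G : mgraph) (M : 'I_3 -> vertex G -> edge G) :=
  (forall i, matching_fun (M i)) /\
  (forall i j, i != j -> exists v, M i v != M j v).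

Lemma matchable_triple (G : mgraph) : matchable 3 G ->
  exists M : 'I_3 -> vertex G -> edge G, matching_triple M.
Proof.
rewrite /matchable => h3.
pose f (i : 'I_3) := enum_val (widen_ord h3 i).
have fP i : exists F, matching_fun F /\ f i = [set F v | v in vertex G].
  have := enum_valP (widen_ord h3 i); rewrite inE.
  by case/perfect_matching_fun=> F mF E; exists F.
have [M MP] := fin_all_exists fP.
exists M; split=> [i|i j]; first by case: (MP i).
move=> ij; apply/existsP; apply: contraNT ij.
rewrite negb_exists => /forallP H; apply/eqP.
suff : f i = f j by move/enum_val_inj/(congr1 val) => /= /val_inj.
case: (MP i) => _ ->; case: (MP j) => _ ->; apply: eq_imset => v.
by apply/eqP; have := H v; rewrite negbK.
Qed.

(** After deletion of an edge missed by all three matchings, these would still be three distinct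
    perfect matchings. *)
Lemma minimal_triple_cover (G : mgraph) (M : 'I_3 -> vertex G -> edge G) :
  minimally_matchable 3 G -> matching_triple M ->
  forall e, exists i v, e = M i v.
Proof.
move=> [_ minG] [mM dM] e.
have : [exists i, exists v, e == M i v].
  apply: contraT; rewrite negb_exists => /forallP ne.
  have neM i v : M i v != e.
    by have := ne i; rewrite negb_exists => /forallP/(_ v); rewrite eq_sym.
  case: (minG e); rewrite /matchable.
  pose M' i v : edge (del_edge e) := Sub (M i v) (neM i v).
  have mM' i : @matching_fun (del_edge e) (M' i).
    split=> v; first by rewrite /= matching_ends.
    by apply: val_inj; rewrite /= -[RHS](matching_mate (mM i)).
  pose g i := [set M' i v | v in vertex G].
  have gI : injective g.
    move=> i j E; apply/eqP; apply: contraT => /dM[v].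
    have /(congr1 val) /= := @matching_fun_inj (del_edge e) _ _ (mM' i) (mM' j) E v.
    by move=> ->; rewrite eqxx.
  rewrite -[3]card_ord -cardsT -(card_imset _ gI); apply: subset_leq_card.
  apply/subsetP=> _ /imsetP[i _ ->]; rewrite inE.
  exact: (@matching_perfect (del_edge e)).
by case/existsP=> i /existsP[v /eqP]; exists i, v.
Qed.

Section Gluing.
Variables (G : mgraph) (I : Type) (M : I -> vertex G -> edge G).
Hypothesis mM : forall i, matching_fun (M i).

Lemma matching_glue (c : vertex G -> I) :
  (forall v, M (c (mate (M (c v)) v)) (mate (M (c v)) v) = M (c v) v) ->
  matching_fun (fun v => M (c v) v).
Proof. by move=> H; split=> v; [exact: matching_ends | exact: H]. Qed.

End Gluing.

Lemma mate_in_closed (G : mgraph) (F : vertex G -> edge G) (W : {set vertex G}) v :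
  matching_fun F -> {in W, forall v, mate F v \in W} ->
  (mate F v \in W) = (v \in W).
Proof.
move=> mF WF; apply/idP/idP => [h|]; last exact: WF.
by rewrite -(mateK mF v) WF.
Qed.

(** * Subdivisions inside a vertex set, and splitting off copies of K2 *)

(** The maps are easier to define out of the constructed graph [H]; finite choice inverts them. *)
Lemma isomorphic_of_inverse (G H : mgraph) (f : vertex H -> vertex G)
    (g : edge H -> edge G) :
  injective f -> (forall v, exists x, f x = v) ->
  injective g -> (forall d, exists e, g e = d) ->
  (forall e, ends (g e) = f @: ends e) -> isomorphic G H.
Proof.
move=> fI /fin_all_exists[f' fK] gI /fin_all_exists[g' gK] E.
have f'K : cancel f f' by move=> x; apply: fI; rewrite fK.
have g'K : cancel g g' by move=> x; apply: gI; rewrite gK.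
exists f', g'; split; [by exists f | by exists g | move=> e].
rewrite -{2}(gK e) E -imset_comp; apply/setP=> x.
apply/idP/imsetP => [xe|[y ye ->]]; first by exists x; rewrite //= f'K.
by rewrite /= f'K.
Qed.

Section Induced.
Variables (G : mgraph) (W : {set vertex G}).

Definition induced_ends (e : {e : edge G | ends e \subset W}) :
  {set {v : vertex G | v \in W}} := [set v | val v \in ends (val e)].

Lemma induced_ends_val (e : {e : edge G | ends e \subset W}) :
  val @: induced_ends e = ends (val e).
Proof.
apply/setP=> v; apply/imsetP/idP => [[x xe ->]|ve]; first by rewrite inE in xe.
have vW : v \in W by apply: (subsetP (valP e)).
by exists (Sub v vW); rewrite ?inE SubK.
Qed.

Lemma card_induced_ends e : #|induced_ends e| = 2.
Proof. by rewrite -(card_imset _ val_inj) induced_ends_val card_ends. Qed.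

Definition induced : mgraph := MGraph card_induced_ends.

(** A vertex outside [W] meets only its [F]-edge, whose other end is outside [W] too. So the edges
    not inside [W] are isolated copies of [K2], indexed by the enumeration of [K]. *)
Lemma isomorphic_K2_union (F : vertex G -> edge G) :
  matching_fun F -> {in W, forall v, mate F v \in W} ->
  (forall e v, v \in ends e -> v \notin W -> e = F v) ->
  exists n, isomorphic G (dunion (copies n K2) induced).
Proof.
move=> mF WF outF.
pose K := [set e : edge G | ends e \subset ~: W].
have repE (e : edge G) : exists v, v \in ends e.
  by have /card_gt0P[v ve] : 0 < #|ends e| by [rewrite card_ends]; exists v.
(* An arbitrary end of each edge serves as the image of vertex 0 of its copy of [K2]. *)
have [rep repP] := fin_all_exists repE.
have FK v : v \notin W -> F v \in K.
  move=> vW; rewrite inE (ends_matching mF); apply/subsetP=> u.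
  rewrite !inE => /orP[]/eqP-> //.
  by rewrite (mate_in_closed _ mF WF).
have KW e v : e \in K -> v \in ends e -> v \notin W.
  by rewrite inE => /subsetP H /H; rewrite inE.
have eK (i : 'I_(#|K|)) : enum_val i \in K by exact: enum_valP.
exists #|K|.
pose f (x : vertex (dunion (copies #|K| K2) induced)) : vertex G :=
  match x with
  | inl (i, b) => if b == ord0 then rep (enum_val i)
                  else other (enum_val i) (rep (enum_val i))
  | inr w => val w
  end.
pose g (x : edge (dunion (copies #|K| K2) induced)) : edge G :=
  match x with inl (i, _) => enum_val i | inr e => val e end.
have fin i (b : 'I_2) : f (inl (i, b)) \in ends (enum_val i).
  by rewrite /f; case: ifP => _ //; exact: other_ends.
have b01 (b : 'I_2) : b = ord0 \/ b = ord_max.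
  by case: b => [[|[|b]] hb] //; [left|right]; exact: val_inj.
have endsK2 (A : edge K2) : ends A = [set: 'I_2].
  apply/eqP; rewrite eqEcard subsetT /= cardsT card_ord.
  by rewrite (eqP (valP A)).
apply: (@isomorphic_of_inverse _ _ f g).
- case=> [[i b]|w] [[j b']|w'].
  + move=> E; have ij : i = j.
      apply: enum_val_inj.
      have h := fin i b; have h' := fin j b'; rewrite -E in h'.
      by rewrite (outF _ _ h) ?(outF _ _ h') //; exact: KW h'.
    subst j; congr (inl (_, _)).
    move: E; rewrite /f.
    have ne := other_neq (repP (enum_val i)).
    case: (b01 b) => ->; case: (b01 b') => -> //= E; move: ne.
      by rewrite -E eqxx.
    by rewrite E eqxx.
  + move=> E; have := KW _ _ (eK i) (fin i b).
    by rewrite E /= (valP w').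
  + move=> E; have := KW _ _ (eK j) (fin j b').
    by rewrite -E /= (valP w).
  + by move=> /= /val_inj ->.
- move=> v; case: (boolP (v \in W)) => vW; first by exists (inr (Sub v vW)).
  have FvK := FK _ vW.
  pose i := enum_rank_in FvK (F v).
  have iE : enum_val i = F v by rewrite enum_rankK_in.
  have vi : v \in ends (enum_val i) by rewrite iE matching_ends.
  case: (mem_ends (repP (enum_val i)) vi) => E.
    by exists (inl (i, ord0)).
  by exists (inl (i, ord_max)).
- case=> [[i A]|e] [[j A']|e'] /=.
  + move=> /enum_val_inj ->; congr (inl (_, _)); apply: val_inj.
    by have := endsK2 A; rewrite /= => ->; have := endsK2 A'.
  + move=> E; have /card_gt0P[v ve] : 0 < #|ends (enum_val i)| by rewrite card_ends.
    have := KW _ _ (eK i) ve; rewrite (subsetP (valP e')) //=.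
    by rewrite -[sval e']E.
  + move=> E; have /card_gt0P[v ve] : 0 < #|ends (enum_val j)| by rewrite card_ends.
    have := KW _ _ (eK j) ve; rewrite (subsetP (valP e)) //=.
    by rewrite [sval e]E.
  + by move=> /val_inj ->.
- move=> d; case: (boolP (d \in K)) => dK.
    have A2 : #|[set: 'I_2]| == 2 by rewrite cardsT card_ord.
    exists (inl (enum_rank_in dK d, Sub [set: 'I_2] A2)) => /=.
    by rewrite enum_rankK_in.
  have dW : ends d \subset W.
    apply/subsetP=> v vd; apply: contraR dK => vW.
    by rewrite (outF _ _ vd vW) FK.
  by exists (inr (Sub d dW)).
- case=> [[i A]|e] /=; last first.
    rewrite -imset_comp -induced_ends_val; exact: eq_imset.
  rewrite /copies_ends /= -!imset_comp.
  rewrite (_ : val A = [set: 'I_2]); last exact: endsK2 A.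
  apply/setP=> v; apply/idP/imsetP => [vi|[b _ ->]]; last exact: fin.
  case: (mem_ends (repP (enum_val i)) vi) => E.
    by exists ord0.
  by exists ord_max.
Qed.

Lemma is_walk_lift (x : vertex induced) (p : seq (edge induced * vertex induced)) :
  is_walk (val x) [seq (val d.1, val d.2) | d <- p] -> is_walk x p.
Proof.
elim: p x => //= [[e y] p IH] x /= /andP[/eqP E /IH ->]; rewrite andbT.
apply/eqP/setP=> v; rewrite inE E !inE.
by rewrite -!val_eqE.
Qed.

Lemma walk_lift_exists (x : vertex G) (p : seq (edge G * vertex G)) :
  is_walk x p -> x \in W -> {subset unzip2 p <= W} ->
  exists p' : seq (edge induced * vertex induced),
    p = [seq (val d.1, val d.2) | d <- p'].
Proof.
elim: p x => [|[e y] p IH] x /=; first by exists [::].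
case/andP=> /eqP E wp xW sW.
have yW : y \in W by apply: sW; rewrite inE eqxx.
have [|p' ->] := IH _ wp yW; first by move=> z zp; apply: sW; rewrite inE zp orbT.
have eW : ends e \subset W by rewrite E; apply/subsetP=> z /set2P[]->.
by exists ((Sub e eW, Sub y yW) :: p').
Qed.

Lemma mem_path_vertices (x : vertex G) p y : y \in unzip2 p ->
  y = path_end x p \/ y \in path_inner x p.
Proof.
case: p => //= [[e z] p]; rewrite /path_end /path_inner /= lastI mem_rcons inE.
by case/orP=> [/eqP|]; auto.
Qed.

(** An odd subdivision of [H] on the vertex set [W], phrased with walks of [G] so that threads can
    be used without passing to the subtypes in [induced]. *)
Definition embedded_subdivision (H : mgraph) : Prop :=
  exists (phi : vertex H -> vertex G) (s : edge H -> vertex G)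
         (p : edge H -> seq (edge G * vertex G)),
    [/\ injective phi,
        forall e, [/\ is_path (s e) (p e), odd (size (p e)) &
                      [set s e; path_end (s e) (p e)] = phi @: ends e],
        [/\ forall e v, phi v \notin path_inner (s e) (p e),
            forall e f, e != f ->
              ~~ has (mem (path_inner (s e) (p e))) (path_inner (s f) (p f)) &
            forall e f, e != f ->
              ~~ has (mem (unzip1 (p e))) (unzip1 (p f))],
        forall x, x \in W <-> ((exists v, x = phi v) \/
                             (exists e, x \in path_inner (s e) (p e))) &
        forall d, ends d \subset W -> exists e, d \in unzip1 (p e)].

Lemma embedded_odd_subdivision (H : mgraph) :
  embedded_subdivision H -> odd_subdivision H induced.
Proof.
case=> phi [s [p [phiI pP [in1 in2 in3] inW dW]]].
have phiW v : exists x : vertex induced, val x = phi v.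
  have h : phi v \in W by apply/inW; left; exists v.
  by exists (Sub (phi v) h).
have [phi' phiE] := fin_all_exists phiW.
have sphi e : exists v, s e = phi v.
  case: (pP e) => _ _ E; have : s e \in [set s e; path_end (s e) (p e)].
    by rewrite !inE eqxx.
  by rewrite E => /imsetP[v _ ->]; exists v.
have endphi e : exists v, path_end (s e) (p e) = phi v.
  case: (pP e) => _ _ E.
  have : path_end (s e) (p e) \in [set s e; path_end (s e) (p e)].
    by rewrite !inE eqxx orbT.
  by rewrite E => /imsetP[v _ ->]; exists v.
have sW e : exists x : vertex induced, val x = s e.
  by have [v ->] := sphi e; exact: phiW.
have [s' sE] := fin_all_exists sW.
have pW e : exists p' : seq (edge induced * vertex induced),
    p e = [seq (val d.1, val d.2) | d <- p'].
  case: (pP e) => /andP[wp _] _ _; apply: (walk_lift_exists wp).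
    by rewrite -sE; exact: (valP (s' e)).
  move=> y /(mem_path_vertices (s e))[->|yi]; apply/inW; last by right; exists e.
  by have [v ->] := endphi e; left; exists v.
have [p' pE] := fin_all_exists pW.
have u2 e : unzip2 (p e) = map val (unzip2 (p' e)).
  by rewrite pE /unzip2 -!map_comp.
have u1 e : unzip1 (p e) = map val (unzip1 (p' e)).
  by rewrite pE /unzip1 -!map_comp.
have innerE e : path_inner (s e) (p e) = map val (path_inner (s' e) (p' e)).
  by rewrite /path_inner u2 -sE belast_map behead_map.
have endE e : path_end (s e) (p e) = val (path_end (s' e) (p' e)).
  by rewrite /path_end u2 -sE last_map.
exists phi', s', p'; split.
- by move=> v w E; apply: phiI; rewrite -!phiE E.
- move=> e; case: (pP e) => /andP[wp up] op E; split.
  + rewrite /is_path; apply/andP; split.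
      by apply: is_walk_lift; rewrite sE -pE.
    by rewrite -(map_inj_uniq val_inj) /= -u2 [sval _]sE.
  + by move: op; rewrite pE size_map.
  + apply: (imset_inj val_inj); rewrite imsetU1 imset_set1 -endE [val (s' e)]sE E.
    by rewrite -imset_comp; apply: eq_imset => v; rewrite /= [sval _]phiE.
- split.
  + by move=> e v; rewrite -(mem_map val_inj) -innerE phiE.
  + move=> e f /in2; apply: contra => /hasP[x xf xe]; apply/hasP; exists (val x).
      by rewrite innerE map_f.
    by rewrite /= innerE map_f.
  + move=> e f /in3; apply: contra => /hasP[x xf xe]; apply/hasP; exists (val x).
      by rewrite u1 map_f.
    by rewrite /= u1 map_f.
- move=> x; case/inW: (valP x) => [[v E]|[e]].
    by left; exists v; apply: val_inj; rewrite phiE.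
  by rewrite innerE (mem_map val_inj); right; exists e.
- move=> d; have [e de] := dW _ (valP d); exists e.
  by move: de; rewrite u1 (mem_map val_inj).
Qed.

End Induced.

(** * Threads *)

Lemma is_walk_map_iota (G : mgraph) (x : nat -> vertex G) (d : nat -> edge G) n k :
  (forall i, k <= i < k + n -> ends (d i) = [set x i; x i.+1]) ->
  is_walk (x k) [seq (d i, x i.+1) | i <- iota k n].
Proof.
elim: n k => //= n IH k H; rewrite H ?eqxx ?IH //=; last lia.
by move=> i hi; apply: H; lia.
Qed.

Section Thread.
Variables (G : mgraph) (F N : vertex G -> edge G) (T D : {set vertex G}).
Hypotheses (mF : matching_fun F) (mN : matching_fun N).

(** Threads are the components of this relation. [N]-edges are followed only at inner vertices, so a
    thread stops when it reaches [T]. *)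
Definition thread_rel : rel (vertex G) :=
  [rel v w | (w == mate F v) || (v \in D) && (w == mate N v)].

Hypotheses (DT : {in D, forall v, v \notin T})
  (FTD : {in T :|: D, forall v, mate F v \in T :|: D})
  (ND : {in D, forall v, mate N v \in D}).

Lemma thread_sym : connect_sym thread_rel.
Proof.
apply: sym_connect_sym => v w; apply/idP/idP; rewrite /thread_rel /=.
  case/orP=> [/eqP->|/andP[vD /eqP->]]; first by rewrite mateK // eqxx.
  by rewrite ND // mateK // eqxx orbT.
case/orP=> [/eqP->|/andP[vD /eqP->]]; first by rewrite mateK // eqxx.
by rewrite ND // mateK // eqxx orbT.
Qed.

Lemma connect_thread_closed (X : {set vertex G}) v w :
  {in X, forall v, mate F v \in X} ->
  {in X, forall v, v \in D -> mate N v \in X} ->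
  connect thread_rel v w -> (v \in X) = (w \in X).
Proof.
move=> XF XN; apply: closed_connect; apply: (intro_closed thread_sym) => x y /=.
by case/orP=> [/eqP->|/andP[xD /eqP->]] xX; [exact: XF|exact: XN].
Qed.

Lemma connect_thread_mate v w :
  connect thread_rel v w -> connect thread_rel v (mate F w).
Proof. by move/connect_trans; apply; apply: connect1; rewrite /thread_rel /= eqxx. Qed.

Lemma connect_thread_inner v w : w \in D ->
  connect thread_rel v w -> connect thread_rel v (mate N w).
Proof.
by move=> wD /connect_trans; apply; apply: connect1; rewrite /thread_rel /= wD eqxx orbT.
Qed.

(** By [thread_vertices] the path exhausts its component, so threads for the same [F], [N] and [D]
    that meet have the same vertices. *)
Record is_thread (t u : vertex G) (p : seq (edge G * vertex G)) : Prop := {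
  thread_path : is_path t p;
  thread_odd : odd (size p);
  thread_end : path_end t p = u;
  thread_endT : u \in T;
  thread_end_neq : u != t;
  thread_inner : {subset path_inner t p <= D};
  thread_vertices : forall v, (v \in t :: unzip2 p) = connect thread_rel t v;
  thread_outer_edge : forall v, connect thread_rel t v -> F v \in unzip1 p;
  thread_inner_edge :
    forall v, connect thread_rel t v -> v \in D -> N v \in unzip1 p;
  thread_edges : forall e, e \in unzip1 p ->
    (exists v, e = F v) \/ (exists2 v, v \in D & e = N v) }.

(** The alternating path for the mates of [F] and [N] has an even number of vertices, hence odd
    length, and its first vertex after [t] outside [D] must be in [T]. *)
Lemma thread_exists t : t \in T -> exists u p, is_thread t u p.
Proof.
move=> tT; have tD : t \notin D by apply/negP=> /DT; rewrite tT.
have [L [Lev L1 xI xD xL]] := @alternating_path _ (mate F) (mate N) D t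
  (mateK mF) (mate_neq mF) (fun v _ => mateK mN v) (fun v _ => mate_neq mN v) ND tD.
set x := altpos _ _ _ in xI xD xL.
have x0 : x 0 = t by [].
have x_even i : ~~ odd i -> x i.+1 = mate F (x i) by exact: altpos_even.
have x_odd i : odd i -> x i.+1 = mate N (x i) by exact: altpos_odd.
have x_evenK i : odd i -> mate F (x i) = x i.-1.
  by case: i => // i oi; rewrite x_even ?mateK.
have x_oddK i : 0 < i -> ~~ odd i -> mate N (x i) = x i.-1.
  by case: i => // i _ oi; rewrite x_odd ?mateK //; apply: negbNE.
have xDP i : i < L -> x i \in D -> 0 < i < L.-1.
  move=> iL iD; have i0 : i <> 0 by move=> E; move: iD; rewrite E (negbTE tD).
  have iL1 : i <> L.-1 by move=> E; move: iD; rewrite E (negbTE xL).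
  lia.
have xTD i : i < L.-1 -> x i \in T :|: D.
  case: (posnP i) => [-> _|i0 iL]; first by rewrite x0 inE tT.
  by rewrite inE xD ?orbT // i0.
pose d i := (if odd i then N else F) (x i).
pose p := [seq (d i, x i.+1) | i <- iota 0 L.-1].
have tp : t :: unzip2 p = map x (iota 0 L).
  rewrite /p /unzip2 -map_comp -{2}(ltn_predK L1).
  by rewrite [iota 0 _.+1]/= (iotaDl 1 0) /= -map_comp.
have p1 : unzip1 p = map d (iota 0 L.-1) by rewrite /p /unzip1 -map_comp.
have p_end : path_end t p = x L.-1.
  rewrite /path_end -(last_cons t) tp -{1}(ltn_predK L1) -addn1 iotaD map_cat.
  by rewrite /= cats1 last_rcons.
have p_inner : path_inner t p = map x (iota 1 L.-2).
  have L2 : iota 0 L = 0 :: rcons (iota 1 L.-2) L.-1.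
    rewrite -{1}(ltn_predK L1) /=; congr (_ :: _).
    have -> : L.-1 = L.-2 + 1 by lia.
    by rewrite iotaD cats1; congr (rcons (iota _ _) _); lia.
  have : unzip2 p = rcons (map x (iota 1 L.-2)) (x L.-1).
    by move: tp; rewrite L2 map_cons map_rcons => -[].
  by rewrite /path_inner => ->; rewrite belast_rcons.
have memx v : (v \in map x (iota 0 L)) <-> exists2 i, i < L & v = x i.
  split=> [/mapP[i]|[i iL ->]]; first by rewrite mem_iota => /andP[_ iL]; exists i.
  by rewrite map_f // mem_iota.
have memd i : i < L.-1 -> d i \in unzip1 p.
  by move=> iL; rewrite p1 map_f // mem_iota.
have conn i : i < L -> connect thread_rel t (x i).
  elim: i => [|i IH] iL; first by rewrite x0 connect0.
  have ci := IH (ltnW iL).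
  case: (boolP (odd i)) => oi.
    rewrite x_odd //; apply: connect_thread_inner => //; apply: xD.
    by case: (i) oi iL => //; lia.
  by rewrite x_even //; exact: connect_thread_mate.
have vert v : (v \in t :: unzip2 p) = connect thread_rel t v.
  rewrite tp; apply/idP/idP => [/memx[i iL ->]|cv]; first exact: conn.
  (* The positions are closed under the steps of the relation, so they fill the component. *)
  pose X := [set v in map x (iota 0 L)].
  have XF : {in X, forall v, mate F v \in X}.
    move=> u; rewrite !inE => /memx[i iL ->]; apply/memx.
    case: (boolP (odd i)) => oi; first by exists i.-1; rewrite ?x_evenK //; lia.
    by exists i.+1; rewrite ?x_even //; lia.
  have XN : {in X, forall v, v \in D -> mate N v \in X}.
    move=> u; rewrite !inE => /memx[i iL ->] iD; apply/memx.
    have iD' := xDP _ iL iD.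
    case: (boolP (odd i)) => oi; first by exists i.+1; rewrite ?x_odd //; lia.
    by exists i.-1; rewrite ?x_oddK //; lia.
  have := connect_thread_closed XF XN cv; rewrite !inE => <-.
  by apply/memx; exists 0 => //; lia.
have cx v : connect thread_rel t v -> exists2 i, i < L & v = x i.
  by rewrite -vert tp => /memx.
exists (x L.-1), p; split=> //.
- rewrite /is_path tp; apply/andP; split.
    rewrite -x0; apply: is_walk_map_iota => i _; rewrite /d.
    case: (boolP (odd i)) => oi; first by rewrite x_odd // ends_matching.
    by rewrite x_even // ends_matching.
  rewrite map_inj_in_uniq ?iota_uniq // => i j; rewrite !mem_iota /=; exact: xI.
- rewrite size_map size_iota; lia.
(* Position [L.-2] is even, so the last step is an [F]-step and stays in [T :|: D]. *)
- have : x L.-1 \in T :|: D.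
    have -> : L.-1 = L.-2.+1 by lia.
    by rewrite x_even ?FTD ?xTD //; lia.
  by rewrite inE (negbTE xL) orbF.
- rewrite -x0; apply/eqP=> /xI; lia.
- by move=> v; rewrite p_inner => /mapP[i]; rewrite mem_iota => hi ->; apply: xD; lia.
- move=> v /cx[i iL ->]; case: (boolP (odd i)) => oi.
    have -> : F (x i) = d i.-1.
      by rewrite -(matching_mate mF) x_evenK // /d; case: (i) oi => //= j /negbTE->.
    by apply: memd; lia.
  have -> : F (x i) = d i by rewrite /d (negbTE oi).
  by apply: memd; lia.
- move=> v /cx[i iL ->] iD; have iD' := xDP _ iL iD.
  case: (boolP (odd i)) => oi.
    have -> : N (x i) = d i by rewrite /d oi.
    by apply: memd; lia.
  have -> : N (x i) = d i.-1.
    rewrite -(matching_mate mN) x_oddK //; last by case/andP: iD'.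
    by rewrite /d; case: (i) oi iD' => //= j; rewrite negbK => ->.
  by apply: memd; lia.
- move=> e; rewrite p1 => /mapP[i]; rewrite mem_iota => hi ->; rewrite /d.
  case: (boolP (odd i)) => oi; [right | left]; exists (x i) => //.
  by apply: xD; case: (i) oi hi => //; lia.
Qed.

Lemma threadT t u p v : is_thread t u p -> t \in T ->
  v \in T -> connect thread_rel t v -> v = t \/ v = u.
Proof.
move=> th tT vT; rewrite -(thread_vertices th) inE.
case/orP=> [/eqP|]; first by left.
case/(mem_path_vertices t) => [->|]; first by right; exact: thread_end th.
by move/(thread_inner th)/DT; rewrite vT.
Qed.

Lemma thread_connect_end t u p : is_thread t u p -> connect thread_rel t u.
Proof.
move=> th; rewrite -(thread_vertices th) -(thread_end th) /path_end.
exact: mem_last.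
Qed.

Lemma thread_vertexP t u p v : is_thread t u p -> connect thread_rel t v ->
  [\/ v = t, v = u | v \in path_inner t p].
Proof.
move=> th; rewrite -(thread_vertices th) inE => /orP[/eqP->|].
  by constructor 1.
by case/(mem_path_vertices t) => [->|]; [constructor 2; rewrite (thread_end th)|constructor 3].
Qed.

Lemma thread_inner_connect t u p v : is_thread t u p ->
  v \in path_inner t p -> connect thread_rel t v.
Proof.
move=> th vi; rewrite -(thread_vertices th); apply: mem_belast.
exact: mem_behead vi.
Qed.

End Thread.

Lemma walk_edge_ends (G : mgraph) (x : vertex G) p d : is_walk x p ->
  d \in unzip1 p -> {subset ends d <= x :: unzip2 p}.
Proof.
elim: p x => //= [[e y] p] IH x /= /andP[/eqP E wp]; rewrite inE.
case/orP=> [/eqP->|dp] v; first by rewrite E !inE => /orP[]/eqP->; rewrite eqxx ?orbT.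
by move=> vd; rewrite inE (IH _ wp dp) ?orbT.
Qed.

(** * Subdivisions assembled from threads of several colours *)

Section ThreadSystem.
Variables (G : mgraph) (I : finType) (F N : I -> vertex G -> edge G).
Variables (T : {set vertex G}) (D : I -> {set vertex G}).
Hypotheses (mF : forall i, matching_fun (F i)) (mN : forall i, matching_fun (N i)).
Hypotheses (DT : forall i, {in D i, forall v, v \notin T})
  (DD : forall i j v, v \in D i -> v \in D j -> i = j)
  (FTD : forall i, {in T :|: D i, forall v, mate (F i) v \in T :|: D i})
  (ND : forall i, {in D i, forall v, mate (N i) v \in D i}).

Notation branch := {v : vertex G | v \in T}.
Notation conn i := (connect (thread_rel (F i) (N i) (D i))).

Definition thread_system (tau : I -> branch -> branch)
    (p : I -> branch -> seq (edge G * vertex G)) :=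
  forall i t, is_thread (F i) (N i) T (D i) (val t) (val (tau i t)) (p i t).

Lemma thread_system_exists : exists tau p, thread_system tau p.
Proof.
have H (it : I * branch) : exists up : branch * seq (edge G * vertex G),
    is_thread (F it.1) (N it.1) T (D it.1) (val it.2) (val up.1) up.2.
  have [u [p th]] := thread_exists (mF it.1) (mN it.1) (@DT it.1) (@FTD it.1)
    (@ND it.1) (valP it.2).
  by exists (Sub u (thread_endT th), p).
have [f fP] := fin_all_exists H.
exists (fun i t => (f (i, t)).1), (fun i t => (f (i, t)).2) => i t.
exact: (fP (i, t)).
Qed.

Variables (tau : I -> branch -> branch)
  (p : I -> branch -> seq (edge G * vertex G)).
Hypothesis th : thread_system tau p.

Lemma conn_sym i v w : conn i v w = conn i w v.
Proof. exact: thread_sym. Qed.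

Lemma conn_branch i t u : conn i (val t) (val u) -> u = t \/ u = tau i t.
Proof.
by case/(threadT (@DT i) (th i t) (valP t) (valP u)) => /val_inj; auto.
Qed.

Lemma conn_tau i t : conn i (val t) (val (tau i t)).
Proof. exact: thread_connect_end (th i t). Qed.

Lemma conn_common i t u v : conn i (val t) v -> conn i (val u) v ->
  u = t \/ u = tau i t.
Proof.
by rewrite [conn i (val u) v]conn_sym => a b; exact/conn_branch/(connect_trans a b).
Qed.

Lemma tau_neq i t : tau i t != t.
Proof. by rewrite -val_eqE; exact: thread_end_neq (th i t). Qed.

(** The thread from [tau i t] contains [t], and its only vertices in [T] are its two ends. *)
Lemma tauK i : involutive (tau i).
Proof.
move=> t; have h := conn_tau i t; rewrite conn_sym in h.
case: (conn_branch h) => // E.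
by have := tau_neq i t; rewrite -E eqxx.
Qed.

Hypotheses (F_diff : forall i j v, v \in T -> F i v = F j v -> i = j)
  (cover : forall i v, v \in D i -> exists t : branch, conn i (val t) v)
  (edgeT : forall d v, v \in T -> v \in ends d -> exists i, d = F i v)
  (edgeD : forall i d v, v \in D i -> v \in ends d -> d = F i v \/ d = N i v).

Variables (H : mgraph) (phi : vertex H -> branch) (col : edge H -> I)
  (s : edge H -> branch).
Hypotheses (phi_inj : injective phi) (phi_surj : forall t, exists v, phi v = t)
  (s_ends : forall e, [set s e; tau (col e) (s e)] = phi @: ends e)
  (s_inj : forall e f, col e = col f ->
     s f = s e \/ s f = tau (col e) (s e) -> e = f)
  (s_surj : forall i t, exists2 e, col e = i & t = s e \/ t = tau i (s e)).

(** By [s_inj] and [s_surj], the edges of [H] correspond one-to-one to the threads, each counted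
    once although it can be started from either end. Two threads sharing an inner vertex or an edge
    have the same colour, hence coincide. *)
Lemma thread_system_subdivision :
  embedded_subdivision (T :|: \bigcup_i D i) H.
Proof.
have onT i (t : branch) v : conn i (val t) v -> v \in T \/ v \in D i.
  case/(thread_vertexP (th i t)) => [->|->|/(thread_inner (th i t))]; auto.
  - by left; exact: valP.
  - by left; exact: valP.
have startE i (t : branch) v : conn i (val t) v -> exists2 e, col e = i & conn i (val (s e)) v.
  have [e ce ts] := s_surj i t => tv; exists e => //.
  by case: ts tv => -> // h; exact: connect_trans (conn_tau _ _) h.
have same e f v : conn (col e) (val (s e)) v -> conn (col f) (val (s f)) v ->
    col e = col f -> e = f.
  move=> a b E; apply: s_inj => //; rewrite -E in b; exact: conn_common a b.
exists (val \o phi), (val \o s), (fun e => p (col e) (s e)); split=> /=.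
- by move=> v w /val_inj/phi_inj.
- move=> e; have te := th (col e) (s e); split.
  + exact: thread_path te.
  + exact: thread_odd te.
  + by rewrite (thread_end te) imset_comp -s_ends imsetU1 imset_set1.
- split.
  + move=> e v; apply/negP=> /(thread_inner (th _ _))/DT.
    by rewrite (valP (phi v)).
  + move=> e f; apply: contraNN => /hasP[x xf xe]; apply/eqP.
    apply: (@same _ _ x).
    * exact: thread_inner_connect (th _ _) xe.
    * exact: thread_inner_connect (th _ _) xf.
    * apply: (@DD _ _ x); [exact: thread_inner (th _ _) _ xe|].
      exact: thread_inner (th _ _) _ xf.
  + move=> e f; apply: contraNN => /hasP[d df de]; apply/eqP.
    have onp g : d \in unzip1 (p (col g) (s g)) ->
        {in ends d, forall v, conn (col g) (val (s g)) v}.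
      move=> dg v vd; rewrite -(thread_vertices (th _ _)).
      have /andP[wp _] := thread_path (th (col g) (s g)).
      exact: walk_edge_ends wp dg _ vd.
    have [v vd] : exists v, v \in ends d.
      by apply/card_gt0P; rewrite card_ends.
    have ve := onp _ de _ vd; have vf := onp _ df _ vd.
    apply: (same _ _ _ ve vf).
    (* The end [v] determines the colour of the common edge: if [v] is inner it lies in a single
       [D i], and if [v] is in [T] the edge must be an [F]-edge, as [N]-edges stay inside [D]. *)
    case: (boolP (v \in T)) => vT; last first.
      case: (onT _ _ _ ve) => [|vDe]; first by rewrite (negbTE vT).
      case: (onT _ _ _ vf) => [|vDf]; first by rewrite (negbTE vT).
      exact: DD vDe vDf.
    have FE g : d \in unzip1 (p (col g) (s g)) -> d = F (col g) v.
      case/(thread_edges (th _ _)) => [[w dw]|[w wD dw]].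
        by rewrite dw; apply/esym/matching_eq => //; rewrite -dw.
      have : v \in D (col g).
        by move: vd; rewrite dw ends_matching // => /set2P[]->; rewrite ?ND.
      by move/DT; rewrite vT.
    by apply: (F_diff vT); rewrite -FE // -FE.
- move=> x; split.
    case/setUP=> [xT|/bigcupP[i _ xD]].
      by left; have [v E] := phi_surj (Sub x xT); exists v; rewrite E.
    right; have [t tx] := cover xD; have [e ce ex] := startE _ _ _ tx.
    exists e; rewrite ce; case: (thread_vertexP (th i (s e)) ex) => // E.
      by move: (DT xD); rewrite E (valP (s e)).
    by move: (DT xD); rewrite E (valP (tau i (s e))).
  case=> [[v ->]|[e /(thread_inner (th _ _)) xD]].
    by rewrite inE (valP (phi v)).
  by rewrite inE; apply/orP; right; apply/bigcupP; exists (col e).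
- move=> d dW; have [v vd] : exists v, v \in ends d.
    by apply/card_gt0P; rewrite card_ends.
  case/setUP: (subsetP dW _ vd) => [vT|/bigcupP[i _ vD]].
    have [i dE] := edgeT vT vd.
    have [e ce ev] := startE i (Sub v vT) v (connect0 _ _).
    exists e; rewrite ce dE; exact: thread_outer_edge (th _ _) _ ev.
  have [t tx] := cover vD; have [e ce ev] := startE _ _ _ tx.
  exists e; rewrite ce; case: (edgeD vD vd) => ->.
    exact: thread_outer_edge (th _ _) _ ev.
  exact: thread_inner_edge (th _ _) _ ev vD.
Qed.

End ThreadSystem.

(** * Two disjoint alternating cycles *)

Definition K2_union_subdivision (G : mgraph) : Prop :=
  exists (n : nat) (S : mgraph),
    isomorphic G (dunion (copies n K2) S) /\
    (odd_subdivision (dunion two_cycle two_cycle) S \/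
     odd_subdivision theta S \/
     odd_subdivision K4 S).

Lemma matching_switch (G : mgraph) (A B : vertex G -> edge G) (Z : {set vertex G}) :
  matching_fun A -> matching_fun B ->
  {in Z, forall v, mate A v \in Z} -> {in Z, forall v, mate B v \in Z} ->
  matching_fun (fun v => if v \in Z then B v else A v).
Proof.
move=> mA mB ZA ZB; split=> v; first by case: ifP => _; exact: matching_ends.
case: (boolP (v \in Z)) => vZ.
  by rewrite -/(mate B v) ZB // matching_mate.
by rewrite -/(mate A v) (mate_in_closed v mA ZA) (negbTE vZ) matching_mate.
Qed.

Section TwoCycles.
Variables (G : mgraph) (A B : vertex G -> edge G) (X : {set vertex G}).
Variables x y : vertex G.
Hypotheses (hG : minimally_matchable 3 G) (mA : matching_fun A) (mB : matching_fun B).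
Hypotheses (XA : {in X, forall v, mate A v \in X})
  (XB : {in X, forall v, mate B v \in X}).
Hypotheses (xX : x \in X) (yX : y \notin X) (xAB : A x != B x) (yAB : A y != B y).

(** With every vertex counted as inner, the threads are whole components of the union of [A] and
    [B]. *)
Let r := connect (thread_rel A B [set: vertex G]).
Let C z := [set v | r z v].
Let T := [set x; mate A x; y; mate A y].
Let W := C x :|: C y.

Lemma mem_cycle z : z \in C z.
Proof. by rewrite inE /r connect0. Qed.

Lemma cycle_closedA z : {in C z, forall v, mate A v \in C z}.
Proof. by move=> v; rewrite !inE; exact: connect_thread_mate. Qed.

Lemma cycle_closedB z : {in C z, forall v, mate B v \in C z}.
Proof. by move=> v; rewrite !inE; apply: connect_thread_inner; rewrite inE. Qed.

Lemma cycle_least z (Y : {set vertex G}) :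
  {in Y, forall v, mate A v \in Y} -> {in Y, forall v, mate B v \in Y} ->
  z \in Y -> {subset C z <= Y}.
Proof.
move=> YA YB zY v; rewrite inE => zv.
have TB : {in [set: vertex G], forall v, mate B v \in [set: vertex G]} by move=> ?.
have YB' : {in Y, forall v, v \in [set: vertex G] -> mate B v \in Y}.
  by move=> ? ? _; exact: YB.
by rewrite -(connect_thread_closed mA mB TB YA YB' zv).
Qed.

Lemma cycle_x v : v \in C x -> v \in X.
Proof. exact: cycle_least. Qed.

Lemma cycle_y v : v \in C y -> v \notin X.
Proof.
move=> vy; rewrite -in_setC; apply: (cycle_least _ _ _ vy); rewrite ?in_setC //.
  by move=> u; rewrite !in_setC (mate_in_closed u mA XA).
by move=> u; rewrite !in_setC (mate_in_closed u mB XB).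
Qed.

(** The matchings [A], [A] switched to [B] on [C x], and [A] switched to [B] on [C y] differ at [x]
    or [y], because [X] separates the two cycles. By minimality they cover all edges. *)
Lemma two_cycles_cover e :
  (exists v, e = A v) \/ (exists2 v, v \in W & e = B v).
Proof.
pose Z (i : 'I_3) : {set vertex G} := nth set0 [:: set0; C x; C y] i.
have ZA i : {in Z i, forall v, mate A v \in Z i}.
  case: i => [[|[|[|i]]] hi] v //=; rewrite /Z /=; try exact: cycle_closedA.
  by rewrite inE.
have ZB i : {in Z i, forall v, mate B v \in Z i}.
  case: i => [[|[|[|i]]] hi] v //=; rewrite /Z /=; try exact: cycle_closedB.
  by rewrite inE.
pose M (i : 'I_3) v := if v \in Z i then B v else A v.
have xCy : x \in C y = false by apply: contraTF xX => /cycle_y.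
have yCx : y \in C x = false by apply: contraNF yX => /cycle_x.
have tM : matching_triple M.
  split=> [i|i j ij]; first exact: matching_switch.
  have sep v : A v != B v -> v \in Z i != (v \in Z j) -> M i v != M j v.
    by move=> vAB; rewrite /M; case: ifP; case: ifP => //= _ _ _; rewrite eq_sym.
  have [sx|sy] : (x \in Z i != (x \in Z j)) \/ (y \in Z i != (y \in Z j)).
    case: i j ij {sep} => [[|[|[|i]]] hi] // [[|[|[|j]]] hj] //= _;
    by rewrite /Z /= ?in_set0 ?xCy ?yCx ?mem_cycle; auto.
  - by exists x; exact: sep.
  - by exists y; exact: sep.
have [i [v ->]] := minimal_triple_cover hG tM e.
rewrite /M; case: ifP => [vZ|_]; [right|by left; exists v].
exists v => //; rewrite inE; apply/orP; case: i vZ => [[|[|[|i]]] hi] //;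
  rewrite /Z /= ?inE; auto.
Qed.

(** The vertices of [T] play the part of branch vertices: each cycle splits into one [A]-edge and
    the complementary path, which form a subdivided 2-cycle. *)
Lemma two_cycles_subdivision : K2_union_subdivision G.
Proof.
(* Colour [false] yields the single [A]-edges, without inner vertices; colour [true] starts with a
   [B]-edge and runs round the rest of the cycle. *)
pose F (b : bool) := if b then B else A.
pose D (b : bool) := if b then W :\: T else set0.
pose N (b : bool) := A.
have mF b : matching_fun (F b) by case: b.
have mN b : matching_fun (N b) by [].
have TA : {in T, forall v, mate A v \in T}.
  move=> v; rewrite !inE -!orbA => /or4P[]/eqP->;
    by rewrite ?mateK // eqxx ?orbT.
have WA : {in W, forall v, mate A v \in W}.
  by move=> v /setUP[] h; rewrite in_setU (cycle_closedA h) ?orbT.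
have xW : x \in W by rewrite in_setU mem_cycle.
have yW : y \in W by rewrite in_setU mem_cycle orbT.
have TW : {subset T <= W}.
  by move=> v; case/setUP=> [/setUP[/setUP[]|]|] /set1P-> //; exact: WA.
have WB : {in W, forall v, mate B v \in W}.
  by move=> v /setUP[] h; rewrite in_setU (cycle_closedB h) ?orbT.
have xCy v : v \in C x -> v \in C y -> False by move=> /cycle_x a /cycle_y /negP[].
have DT b : {in D b, forall v, v \notin T}.
  by case: b => v; rewrite inE // => /andP[].
have DD i j v : v \in D i -> v \in D j -> i = j.
  by case: i; case: j => //; rewrite /D in_set0.
have TD : T :|: D true = W.
  apply/setP=> v; rewrite in_setU /D in_setD.
  by case: (boolP (v \in T)) => //= vT; rewrite (TW _ vT).
have FTD b : {in T :|: D b, forall v, mate (F b) v \in T :|: D b}.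
  case: b; first by rewrite TD.
  by move=> v; rewrite /D setU0; exact: TA.
have ND b : {in D b, forall v, mate (N b) v \in D b}.
  case: b => v; last by rewrite inE.
  rewrite /D !in_setD (mate_in_closed v mA TA) => /andP[-> /WA] //.
have [tau [p th]] := thread_system_exists mF mN DT FTD ND.
have xT : x \in T by rewrite !inE eqxx.
have mxT : mate A x \in T by exact: TA.
have yT : y \in T by rewrite !inE eqxx ?orbT.
have myT : mate A y \in T by exact: TA.
pose branch := {v : vertex G | v \in T}.
pose bx : branch := Sub x xT; pose bmx : branch := Sub (mate A x) mxT.
pose by_ : branch := Sub y yT; pose bmy : branch := Sub (mate A y) myT.
have TC z v : z = x \/ z = y -> v \in T -> v \in C z -> v = z \/ v = mate A z.
  have := mem_cycle x; have := mem_cycle y => yy xx.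
  have mxx := cycle_closedA xx; have myy := cycle_closedA yy.
  move=> zE vT vC; move: vT; rewrite !inE -!orbA => /or4P[]/eqP E; rewrite E in vC *;
  by case: zE vC => -> vC; auto; exfalso; first [exact: (xCy _ vC) | exact: (xCy _ _ vC)].
have tauF (t : branch) : val (tau false t) = mate A (val t).
  pose Y := [set val t; mate A (val t)].
  have YA : {in Y, forall v, mate (F false) v \in Y}.
    by move=> v /set2P[]->; rewrite !inE ?mateK // eqxx ?orbT.
  have := conn_tau th false t.
  move/(connect_thread_closed (mF false) (mN false) (@ND false) YA) => H.
  have : val (tau false t) \in Y.
    by rewrite -H ?inE ?eqxx // => v _; rewrite inE.
  by case/set2P=> // E; have := tau_neq th false t; rewrite -val_eqE E eqxx.
have connC z v : connect (thread_rel (F true) (N true) (D true)) z v -> v \in C z.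
  move/(connect_thread_closed (mF true) (mN true) (@ND true)) => H.
  rewrite -(H (C z)) ?mem_cycle // => u; first exact: cycle_closedB.
  by move=> h _; exact: cycle_closedA.
have tauT (t : branch) : val t = x \/ val t = y ->
    val (tau true t) = mate A (val t).
  move=> tE; have := connC _ _ (conn_tau th true t).
  case/(TC _ _ tE (valP _)) => // E.
  by have := tau_neq th true t; rewrite -val_eqE E eqxx.
have tauxy b (t : branch) : val t = x \/ val t = y ->
    val (tau b t) = mate A (val t).
  by case: b => h; [exact: tauT | exact: tauF].
have Cconn (t : branch) v : val t = x \/ val t = y -> v \in C (val t) ->
    connect (thread_rel (F true) (N true) (D true)) (val t) v.
  move=> tE vC.
  (* The thread is closed under [A] also at its two ends, which [A] interchanges, so it contains the
     whole cycle. *)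
  pose Y := [set v | connect (thread_rel (F true) (N true) (D true)) (val t) v].
  suff : v \in Y by rewrite inE.
  apply: (cycle_least _ _ _ vC); last by rewrite inE connect0.
    move=> u; rewrite !inE => tu; case: (boolP (u \in D true)) => uD.
      exact: connect_thread_inner tu.
    have uT : u \in T.
      apply: contraNT uD => uT; rewrite inE uT.
      by case/setUP: (TW _ (valP t)) => h; have := connC _ _ tu;
        case: tE => ->; rewrite !inE => ->; rewrite ?orbT.
    case: (conn_branch DT th (u := Sub u uT) tu) => /(congr1 val) /= ->.
      by rewrite -[mate _ _](tauT _ tE); exact: (conn_tau th true t).
    by rewrite [sval (tau _ _)](tauT _ tE) mateK // connect0.
  move=> u; rewrite !inE; exact: connect_thread_mate.
have cover i v : v \in D i ->
    exists t : branch, connect (thread_rel (F i) (N i) (D i)) (val t) v.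
  case: i; last by rewrite inE.
  rewrite inE => /andP[_ /setUP[] h].
    by exists bx; apply: Cconn; auto.
  by exists by_; apply: Cconn; auto.
have AB d v : v \in ends d -> d = A v \/ d = B v.
  case: (two_cycles_cover d) => [[u ->]|[u _ ->]] h.
    by left; apply/esym/matching_eq.
  by right; apply/esym/matching_eq.
have F_diff i j v : v \in T -> F i v = F j v -> i = j.
  move=> vT; have vAB : A v != B v.
    have mAB u : A u != B u -> A (mate A u) != B (mate A u).
      apply: contraNN => /eqP E; rewrite matching_mate // in E.
      rewrite E eq_sym; apply/eqP/matching_eq => //.
      by rewrite -E matching_ends.
    by move: vT; rewrite !inE -!orbA => /or4P[]/eqP-> //; exact: mAB.
  by rewrite /F; case: i; case: j => // E; move: vAB; rewrite E eqxx.
have edgeT d v : v \in T -> v \in ends d -> exists i, d = F i v.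
  by move=> _ /AB[]->; [exists false | exists true].
have edgeD i d v : v \in D i -> v \in ends d -> d = F i v \/ d = N i v.
  case: i; last by rewrite inE.
  by move=> _ /AB[]->; auto.
pose Hd := dunion two_cycle two_cycle.
pose phi (u : vertex Hd) : branch := match u with
  | inl a => if a == ord0 then bx else bmx
  | inr a => if a == ord0 then by_ else bmy end.
pose s (e : edge Hd) : branch := match e with inl _ => bx | inr _ => by_ end.
pose col (e : edge Hd) : bool := match e with inl a => a != ord0 | inr a => a != ord0 end.
have b01 (b : 'I_2) : b = ord0 \/ b = ord_max.
  by case: b => [[|[|b]] hb] //; [left|right]; exact: val_inj.
have colI (a b : 'I_2) : (a != ord0) = (b != ord0) -> a = b.
  by case: (b01 a) => ->; case: (b01 b) => ->.
have taux b : tau b bx = bmx by apply: val_inj; rewrite tauxy //; left.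
have tauy b : tau b by_ = bmy by apply: val_inj; rewrite tauxy //; right.
have nxy : x != y by apply: contraNneq yX => <-.
have nxm : mate A x != x by exact: mate_neq.
have nym : mate A y != y by exact: mate_neq.
have nxmy : x != mate A y.
  by apply/eqP=> E; apply: (xCy x); rewrite ?mem_cycle // E cycle_closedA ?mem_cycle.
have nymx : y != mate A x.
  by apply/eqP=> E; apply: (xCy y); rewrite ?mem_cycle // E cycle_closedA ?mem_cycle.
have nmm : mate A x != mate A y by rewrite (can_eq (mateK mA)).
have phi_inj : injective phi.
  case=> a; case=> b; rewrite /phi; case: (b01 a) => ->; case: (b01 b) => -> //=;
  move/(congr1 val) => /= /eqP E; exfalso; move: E; apply/negP=> //; by rewrite eq_sym.
have branchP (t : branch) : [\/ t = bx, t = bmx, t = by_ | t = bmy].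
  by have := valP t; rewrite !inE -!orbA => /or4P[]/eqP E;
    [constructor 1|constructor 2|constructor 3|constructor 4]; apply: val_inj.
have phi_surj t : exists v, phi v = t.
  by case: (branchP t) => ->; [exists (inl ord0)|exists (inl ord_max)|
    exists (inr ord0)|exists (inr ord_max)].
have ordT (f : 'I_2 -> branch) : f @: [set: 'I_2] = [set f ord0; f ord_max].
  apply/setP=> t; apply/imsetP/set2P => [[a _ ->]|[]->]; last 2 first.
  - by exists ord0.
  - by exists ord_max.
  by case: (b01 a) => ->; auto.
have s_ends e : [set s e; tau (col e) (s e)] = phi @: ends e.
  by case: e => a; rewrite /= -imset_comp ordT /= ?taux ?tauy.
have s_inj e f : col e = col f -> s f = s e \/ s f = tau (col e) (s e) -> e = f.
  have nb1 : bx <> by_ by move/(congr1 val) => /= E; rewrite E eqxx in nxy.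
  have nb2 : bx <> bmy by move/(congr1 val) => /= E; rewrite E eqxx in nxmy.
  have nb3 : by_ <> bmx by move/(congr1 val) => /= E; rewrite E eqxx in nymx.
  case: e => a; case: f => b /=; rewrite ?taux ?tauy.
  - by move/colI->.
  - by move=> _ [/esym|].
  - by move=> _ [].
  - by move/colI->.
have s_surj i t : exists2 e, col e = i & t = s e \/ t = tau i (s e).
  pose a : 'I_2 := if i then ord_max else ord0.
  have ai : (a != ord0) = i by rewrite /a; clear; case: i.
  by case: (branchP t) => ->; [exists (inl a)|exists (inl a)|exists (inr a)|exists (inr a)];
    rewrite //= ?taux ?tauy; auto.
have := thread_system_subdivision mF mN DT DD ND th F_diff cover edgeT edgeD
  phi_inj phi_surj s_ends s_inj s_surj.
have -> : T :|: \bigcup_i D i = W.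
  by rewrite big_bool /= setU0.
move/embedded_odd_subdivision => sub.
have [|n iso] := isomorphic_K2_union mA WA.
  move=> e v ve vW; case: (two_cycles_cover e) => [[u E]|[u uW E]].
    by rewrite E in ve *; apply/esym/matching_eq.
  case/negP: vW; rewrite E ends_matching // in ve.
  by case/set2P: ve => ->; [|exact: WB].
by exists n, (induced W); split=> //; left.
Qed.

End TwoCycles.

(** * Three perfect matchings *)

Lemma ordS3_neq (i : 'I_3) : ordS i != i.
Proof. by case: i => [[|[|[|i]]] hi]. Qed.

Lemma third_color (i j : 'I_3) : i != j ->
  exists k, [/\ k != i, k != j & forall l, [\/ l = i, l = j | l = k]].
Proof.
(* The three colours add up to 3. *)
move=> ij; pose k : 'I_3 := inord (3 - (i + j)).
have ij' : (i : nat) <> j by move=> E; case/eqP: ij; exact: val_inj.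
have kE : (k : nat) = 3 - (i + j).
  by rewrite inordK //; case: i j ij' {k ij} => [i hi] [j hj] /=; lia.
exists k; split.
- rewrite -val_eqE /= kE; case: i j ij' {k kE ij} => [i hi] [j hj] /=; lia.
- rewrite -val_eqE /= kE; case: i j ij' {k kE ij} => [i hi] [j hj] /=; lia.
- move=> l; case: (eqVneq l i) => [->|li]; first by constructor 1.
  case: (eqVneq l j) => [->|lj]; first by constructor 2.
  constructor 3; apply: val_inj; rewrite /= kE.
  move: li lj; rewrite -!val_eqE /=; case: i j l ij' {k kE ij} => [i hi] [j hj] [l hl] /=.
  lia.
Qed.

Section Triple.
Variables (G : mgraph) (M : 'I_3 -> vertex G -> edge G).
Hypotheses (hG : minimally_matchable 3 G) (tM : matching_triple M).

Let mM i : matching_fun (M i). Proof. by case: tM. Qed.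

(** Since the matchings cover all edges, these are the vertices of degree 3. *)
Definition branch_set : {set vertex G} := [set v | injectiveb (M^~ v)].

Definition inner_set (i : 'I_3) : {set vertex G} :=
  [set v | [forall j, (j != i) ==> (M j v != M i v)] &&
           [forall j, forall k, (j != i) ==> (k != i) ==> (M j v == M k v)]].

Notation T := branch_set.
Notation D := inner_set.
Notation branch := {v : vertex G | v \in T}.

(** On [inner_set i] the two matchings other than [i] agree, so [ordS i] is an arbitrary choice
    between them. *)
Definition inner_matching (i : 'I_3) := M (ordS i).
Notation N := inner_matching.
Notation conn i := (connect (thread_rel (M i) (N i) (D i))).

Lemma branchP v : reflect (injective (M^~ v)) (v \in T).
Proof. by rewrite inE; exact: injectiveP. Qed.

Lemma innerP i v : reflect ((forall j, j != i -> M j v <> M i v) /\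
  (forall j k, j != i -> k != i -> M j v = M k v)) (v \in D i).
Proof.
rewrite inE; apply: (iffP andP) => [[/forallP a /forallP b]|[a b]]; split.
- by move=> j ji; have := a j; rewrite ji => /eqP.
- by move=> j k ji ki; have /forallP/(_ k) := b j; rewrite ji ki => /eqP.
- by apply/forallP=> j; apply/implyP=> ji; apply/eqP/a.
- by apply/forallP=> j; apply/forallP=> k; apply/implyP=> ji; apply/implyP=> ki; apply/eqP/b.
Qed.

Lemma color_step i v w : w \in ends (M i v) -> M i w = M i v.
Proof. exact: matching_eq. Qed.

(** Whether [M i] and [M j] share the edge [M i v] depends on this edge alone, so the answer is the
    same at both ends. *)
Lemma color_transfer i j v w : w \in ends (M i v) ->
  (M j w == M i w) = (M j v == M i v).
Proof.
move=> wv; have wi := color_step wv; apply/eqP/eqP => E; last first.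
  by rewrite wi -E; apply: color_step; rewrite E.
rewrite -wi -E; apply: color_step; rewrite E wi; exact: matching_ends.
Qed.

Lemma vertex_cases v :
  [\/ v \in T, exists i, v \in D i | forall i j, M i v = M j v].
Proof.
case: (boolP (v \in T)) => vT; first by constructor 1.
have [i [j [ij E]]] : exists i j, i != j /\ M i v = M j v.
  move: vT; rewrite inE => /injectivePn[i [j ij E]]; by exists i, j.
have [k [ki kj cl]] := third_color ij.
have [kE|kE] := eqVneq (M k v) (M i v).
  constructor 3 => a b.
  have H c : M c v = M i v by case: (cl c) => ->.
  by rewrite !H.
constructor 2; exists k; apply/innerP; split.
  move=> l lk; case: (cl l) => lE; rewrite lE -?E; [|..].
  - by move=> E'; rewrite E' eqxx in kE.
  - by move=> E'; rewrite E' eqxx in kE.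
  - by rewrite lE eqxx in lk.
have H c : c != k -> M c v = M i v by case: (cl c) => -> //; rewrite eqxx.
by move=> a b /H -> /H ->.
Qed.

Lemma inner_notin_branch i : {in D i, forall v, v \notin T}.
Proof.
move=> v /innerP[_ H]; apply/branchP=> inj.
have [k [ks ki _]] := third_color (ordS3_neq i).
by case/eqP: ks; apply: inj; exact: (H _ _ ki (ordS3_neq i)).
Qed.

Lemma inner_disjoint i j v : v \in D i -> v \in D j -> i = j.
Proof.
move=> /innerP[_ a] /innerP[b _]; apply/eqP; apply: contraT => ij.
have [k [ki kj _]] := third_color ij.
by case: (b k kj); apply: a => //; rewrite eq_sym.
Qed.

(** In this form, membership is a property of the edge [M i v], whence the closure under
    [mate (M i)] in [unique_color_mate]. *)
Lemma unique_colorP i v :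
  reflect (forall j, j != i -> M j v <> M i v) (v \in T :|: D i).
Proof.
apply: (iffP setUP) => [[/branchP inj|/innerP[]//]|H].
  by move=> j /eqP ji /inj.
case: (vertex_cases v) => [|[k vk]|E]; [by left | | by case: (H _ (ordS3_neq i))].
case: (eqVneq k i) => [<-|ki]; first by right.
have [l [lk li _]] := third_color ki.
by case: (H l li); case/innerP: vk => _ E; apply: E; rewrite // eq_sym.
Qed.

Lemma unique_color_mate i : {in T :|: D i, forall v, mate (M i) v \in T :|: D i}.
Proof.
move=> v /unique_colorP H; apply/unique_colorP=> j /H /eqP ji; apply/eqP.
by rewrite (color_transfer _ (v := v)) // /mate; exact/other_ends/matching_ends.
Qed.

Lemma inner_edge i j v : v \in D i -> j != i -> M j v = N i v.
Proof. by move=> /innerP[_ H] ji; apply: H => //; exact: ordS3_neq. Qed.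

Lemma inner_mate i : {in D i, forall v, mate (N i) v \in D i}.
Proof.
move=> v vD; have w_ends : mate (N i) v \in ends (N i v).
  exact: (other_ends (matching_ends (mM (ordS i)) v)).
have NE j : j != i -> M j (mate (N i) v) = N i v.
  by move=> ji; rewrite -(inner_edge vD ji); apply: color_step; rewrite (inner_edge vD ji).
apply/innerP; split=> [j ji E|j k ji ki]; last by rewrite !NE.
have /eqP := E; rewrite NE // -(NE _ (ordS3_neq i)) eq_sym.
rewrite (color_transfer i w_ends) => /eqP/esym.
by case/innerP: vD => H _; apply: H; exact: ordS3_neq.
Qed.

Lemma uncolored_vertexP v :
  reflect (forall i j, M i v = M j v) (v \notin T :|: \bigcup_i D i).
Proof.
apply: (iffP idP) => [|H].
  rewrite inE negb_or => /andP[vT vD]; case: (vertex_cases v) => //.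
    by rewrite (negbTE vT).
  by case=> i vi; case/bigcupP: vD; exists i.
apply/setUP=> -[/branchP inj|/bigcupP[i _ /innerP[E _]]].
  by have /eqP := inj _ _ (H (ordS ord0) ord0); rewrite (negbTE (ordS3_neq _)).
by case: (E _ (ordS3_neq i)).
Qed.

Lemma triple_edge d v : v \in ends d -> exists i, d = M i v.
Proof.
move=> vd; have [i [u E]] := minimal_triple_cover hG tM d.
by exists i; rewrite E in vd *; rewrite (color_step vd).
Qed.

(** Without branch vertices each [D i] is closed under all three matchings, and two of these sets
    turn out to be nonempty; a vertex of each gives the two cycles. *)
Lemma no_branch_subdivision : T = set0 -> K2_union_subdivision G.
Proof.
move=> T0.
have some i j : i != j -> exists2 v, M i v <> M j v & exists k, v \in D k.
  case: tM => _ H /H[v /eqP ne]; exists v => //.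
  by case: (vertex_cases v) => [|//|E]; [rewrite T0 inE | case: ne].
have [x _ [i xi]] := some _ _ (ordS3_neq ord0).
(* The colours [ordS i] and [j] are those other than [i]. They agree on [D i], so a vertex where
   they differ lies in another [D k]. *)
have [j [js ji _]] := third_color (ordS3_neq i).
rewrite eq_sym in js.
have [y ne [k yk]] := some _ _ js.
have ki : k != i.
  apply/eqP=> E; case: ne; rewrite E in yk; case/innerP: yk => _; apply=> //.
  exact: ordS3_neq.
have XM l : {in D i, forall v, mate (M l) v \in D i}.
  move=> v vi; case: (eqVneq l i) => [->|li].
    have := @unique_color_mate i v; rewrite T0 set0U; exact.
  by rewrite /mate (inner_edge vi li); exact: inner_mate.
apply: (@two_cycles_subdivision G (M i) (M k) (D i) x y) => //.
- by apply: contraNN ki => yi; rewrite (inner_disjoint yk yi).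
- by case/innerP: xi => H _; rewrite eq_sym; apply/eqP/H.
- by case/innerP: yk => H _; apply/eqP/H; rewrite eq_sym.
Qed.

Let mN i : matching_fun (N i) := mM (ordS i).

(** The vertices of [D i] on no thread from a branch vertex form a set closed under [M i] and [N i].
    These matchings differ inside it at [v] and outside it at [t0]. *)
Lemma uncovered_subdivision (t0 : branch) i v : v \in D i ->
  ~ (exists t : branch, conn i (val t) v) -> K2_union_subdivision G.
Proof.
move=> vi nc.
pose X := [set v in D i | ~~ [exists t : branch, conn i (val t) v]].
have vX : v \in X.
  by apply/setIdP; split=> //; apply/existsP=> H; exact: nc.
have XM : {in X, forall u, mate (M i) u \in X}.
  move=> u /setIdP[ui un].
  have cu (t : branch) : conn i (val t) (mate (M i) u) -> conn i (val t) u.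
    by move/connect_thread_mate; rewrite mateK.
  have nu : ~~ [exists t : branch, conn i (val t) (mate (M i) u)].
    by apply: contraNN un => /existsP[t /cu tu]; apply/existsP; exists t.
  apply/setIdP; split=> //.
  have : mate (M i) u \in T :|: D i by apply: unique_color_mate; rewrite in_setU ui orbT.
  case/setUP=> // muT; case/existsP: nu; exists (Sub (mate (M i) u) muT : branch); exact: connect0.
have XN : {in X, forall u, mate (N i) u \in X}.
  move=> u /setIdP[ui un].
  have mui := inner_mate ui; apply/setIdP; split=> //.
  apply: contraNN un => /existsP[t tu]; apply/existsP; exists t.
  by have := connect_thread_inner mui tu; rewrite mateK.
apply: (@two_cycles_subdivision G (M i) (N i) X v (val t0)) => //.
- by apply/negP=> /setIdP[/inner_notin_branch]; rewrite (valP t0).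
- by case/innerP: vi => H _; rewrite eq_sym; apply/eqP/H/ordS3_neq.
- have /branchP inj := valP t0; apply/eqP=> /inj /esym/eqP.
  by rewrite (negbTE (ordS3_neq i)).
Qed.

(** * Lifting colourings, and the subdivisions of theta and K4 *)

Section Threads.
Variables (tau : 'I_3 -> branch -> branch)
  (p : 'I_3 -> branch -> seq (edge G * vertex G)).
Hypothesis th : thread_system M N D tau p.

Hypothesis cover : forall i v, v \in D i -> exists t : branch, conn i (val t) v.

Section Coloring.
Variable c : branch -> 'I_3.
Hypothesis c_tau : forall t, c (tau (c t) t) = c t.

(** A thread of colour [i] is treated as a whole: matched by [M i] if an end has colour [i], and
    otherwise by [N i] on its inner vertices. The value [ord0] occurs only where all three matchings
    agree. *)
Definition lift_coloring (v : vertex G) : 'I_3 :=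
  if insub v is Some t then c t else
  if [pick i | v \in D i] is Some i then
    if [exists t : branch, (c t == i) && conn i (val t) v] then i else ordS i
  else ord0.

Lemma lift_branch t : lift_coloring (val t) = c t.
Proof. by rewrite /lift_coloring valK. Qed.

Lemma lift_inner i v : v \in D i -> lift_coloring v =
  if [exists t : branch, (c t == i) && conn i (val t) v] then i else ordS i.
Proof.
move=> vi; rewrite /lift_coloring insubN ?(inner_notin_branch vi) //.
case: pickP => [j vj|/(_ i)]; last by rewrite vi.
by rewrite (inner_disjoint vj vi).
Qed.

Lemma c_connected i t u : c t = i -> conn i (val t) (val u) -> c u = i.
Proof.
move=> ct /(conn_branch inner_notin_branch th)[->//|->].
by have := c_tau t; rewrite ct.
Qed.

(** By consistency, either both ends of a thread have its colour or neither does. In the first case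
    its [M i]-edges are chosen at both of their ends; in the second the [N i]-edges match its inner
    vertices among themselves. *)
Lemma lift_matching : matching_fun (fun v => M (lift_coloring v) v).
Proof.
apply: matching_glue => // v.
have on_thread i w : w \in T :|: D i ->
    (exists2 t : branch, c t = i & conn i (val t) w) -> lift_coloring w = i.
  case/setUP=> [wT|wD] [t ct tw].
    by rewrite (lift_branch (Sub w wT)); exact: (c_connected (u := Sub w wT) ct tw).
  by rewrite (lift_inner wD); case: existsP => // -[]; exists t; rewrite ct eqxx.
have on_threadM i w : lift_coloring w = i -> w \in T :|: D i ->
    (exists2 t : branch, c t = i & conn i (val t) w) ->
    M (lift_coloring (mate (M i) w)) (mate (M i) w) = M i w.
  move=> wi wTD [t ct tw]; rewrite (on_thread i) ?matching_mate //.
    exact: unique_color_mate.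
  by exists t => //; exact: connect_thread_mate.
case: (vertex_cases v) => [vT|[i vi]|E].
- have vE := lift_branch (Sub v vT).
  rewrite [\val _]/= in vE.
  rewrite vE; apply: on_threadM => //; first by rewrite in_setU vT.
  by exists (Sub v vT); rewrite ?connect0.
- have vE := lift_inner vi; move: (vE); case: existsP => [[t /andP[/eqP ct tv]]|nx] E.
    rewrite E; apply: on_threadM => //; first by rewrite in_setU vi orbT.
    by exists t.
  rewrite E -/(N i) (lift_inner (inner_mate vi)).
  case: existsP => [[t /andP[ct tw]]|_]; last by rewrite matching_mate.
  case: nx; exists t; rewrite ct.
  by have := connect_thread_inner (inner_mate vi) tw; rewrite mateK.
- set w := mate _ v; have wv : w \in ends (M (lift_coloring v) v).
    exact/other_ends/matching_ends.
  rewrite (E (lift_coloring v) (lift_coloring w)).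
  by apply: color_step; rewrite -(E (lift_coloring v)).
Qed.

(* Replacing one of the three matchings by the lifted one gives another triple,
   which still has to cover every edge. *)
Lemma coloring_constant t u : c t = c u.
Proof.
apply/eqP; apply: contraT => ctu.
pose i := c t; pose L v := M (lift_coloring v) v.
pose M' k := if k == i then L else M k.
(* At [t] the lifted matching agrees with [M i], which keeps it apart from the other two. *)
have Lt k : k != i -> L (val t) != M k (val t).
  move=> ki; rewrite /L lift_branch -/i; have /branchP inj := valP t.
  by apply: contraNneq ki => /inj ->.
have tM' : matching_triple M'.
  split=> [k|j k jk]; first by rewrite /M'; case: ifP => _ //; exact: lift_matching.
  rewrite /M'; case: ifP => [/eqP ji|ji]; case: ifP => [/eqP ki|ki].
  - by rewrite ji ki eqxx in jk.
  - by exists (val t); apply: Lt; rewrite ki.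
  - by exists (val t); rewrite eq_sym; apply: Lt; rewrite ji.
  - by case: tM => _; apply.
(* This edge is the one that gets lost: at [u] the lifted matching has colour [c u], and the two
   matchings kept have colours other than [i]. *)
have [k [w E]] := minimal_triple_cover hG tM' (M i (val u)).
have /branchP inj := valP u.
have uE : M' k (val u) = M i (val u).
  rewrite E; apply: matching_eq; first by case: tM'.
  by rewrite -E matching_ends.
move: uE; rewrite /M'; case: ifP => [_|/eqP ki /inj //].
by rewrite /L lift_branch => /inj E'; move: ctu; rewrite -/i E' eqxx.
Qed.

End Coloring.

Lemma branch_edge d v : v \in T -> v \in ends d -> exists i, d = M i v.
Proof. by move=> _; exact: triple_edge. Qed.

Lemma inner_edges i d v : v \in D i -> v \in ends d -> d = M i v \/ d = N i v.
Proof.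
move=> vi /triple_edge[j ->]; case: (eqVneq j i) => [->|ji]; first by left.
by right; exact: inner_edge.
Qed.

Lemma triple_isomorphic :
  exists n, isomorphic G (dunion (copies n K2) (induced (T :|: \bigcup_i D i))).
Proof.
apply: (isomorphic_K2_union (mM ord0)) => [v vW|e v ve vW].
  apply: contraLR vW => /uncolored_vertexP H; apply/uncolored_vertexP => i j.
  have vw : v \in ends (M ord0 (mate (M ord0) v)).
    by rewrite matching_mate // matching_ends.
  have E k : M k v = M ord0 (mate (M ord0) v).
    by rewrite (H ord0 k); apply: color_step; rewrite -(H ord0 k).
  by rewrite !E.
have [i ->] := triple_edge ve.
by have /uncolored_vertexP := vW; apply.
Qed.

Lemma branch_diff i j v : v \in T -> M i v = M j v -> i = j.
Proof. by move/branchP=> inj /inj. Qed.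

Lemma theta_subdivision : #|{: branch}| = 2 ->
  embedded_subdivision (T :|: \bigcup_i D i) theta.
Proof.
move=> c2.
have [t0 _] : exists t0 : branch, t0 \in {: branch} by apply/card_gt0P; rewrite c2.
pose t1 := tau ord0 t0.
have n10 : t1 != t0 by exact: tau_neq th _ _.
have allT (u : branch) : u = t0 \/ u = t1.
  have : [set t0; t1] == [set: branch].
    by rewrite eqEcard subsetT cardsT c2 cards2 eq_sym n10.
  by move/eqP/setP/(_ u); rewrite !inE => /orP[]/eqP; auto.
have tau0 i : tau i t0 = t1.
  by case: (allT (tau i t0)) => // E; have := tau_neq th i t0; rewrite E eqxx.
have b01 (b : 'I_2) : b = ord0 \/ b = ord_max.
  by case: b => [[|[|b]] hb] //; [left|right]; exact: val_inj.
pose phi (a : vertex theta) := if a == ord0 then t0 else t1.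
apply: (thread_system_subdivision mM mN inner_notin_branch inner_disjoint inner_mate
  th branch_diff cover branch_edge inner_edges (H := theta) (phi := phi)
  (col := id) (s := fun _ => t0)).
- move=> a b; rewrite /phi; case: (b01 a) => ->; case: (b01 b) => -> //= E;
    by rewrite E eqxx in n10.
- by move=> t; case: (allT t) => ->; [exists ord0 | exists ord_max].
- move=> e; rewrite tau0; apply/setP=> t; apply/set2P/imsetP => [[]->|[a _ ->]].
  + by exists ord0.
  + by exists ord_max.
  + by rewrite /phi; case: ifP; auto.
- by move=> e f.
- move=> i t; exists i => //; rewrite tau0; exact: allT.
Qed.

(** By injectivity the three values [tau i t] are the three other branch vertices, so every two
    branch vertices are joined by exactly one thread. *)
Lemma K4_subdivision : #|{: branch}| = 4 -> (forall t, injective (tau^~ t)) ->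
  embedded_subdivision (T :|: \bigcup_i D i) K4.
Proof.
move=> c4 inj.
pose phi (a : vertex K4) : branch := enum_val (cast_ord (esym c4) a).
have phi_inj : injective phi by move=> a b /enum_val_inj/cast_ord_inj.
have phi_surj t : exists a, phi a = t.
  by exists (cast_ord c4 (enum_rank t)); rewrite /phi cast_ordK enum_rankK.
have tau_surj (t u : branch) : u != t -> exists i, tau i t = u.
  move=> ut.
  have : [set tau i t | i in 'I_3] == [set~ t].
    rewrite eqEcard; apply/andP; split.
      by apply/subsetP=> _ /imsetP[i _ ->]; rewrite !inE; exact: tau_neq th _ _.
    by rewrite card_imset ?cardsC1 ?c4 ?card_ord //; exact: inj.
  move/eqP/setP/(_ u); rewrite !inE ut => /imsetP[i _ ->]; by exists i.
have edgeE (e : edge K4) : exists it : 'I_3 * branch,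
    [set it.2; tau it.1 it.2] = phi @: ends e.
  have /cards2P[a [b [ab E]]] := valP e.
  have [|i iE] := tau_surj (phi a) (phi b).
    by rewrite (inj_eq phi_inj) eq_sym.
  by exists (i, phi a); rewrite /= iE E imsetU1 imset_set1.
have [f fE] := fin_all_exists edgeE.
have tK := tauK mM mN inner_notin_branch inner_mate th.
apply: (thread_system_subdivision mM mN inner_notin_branch inner_disjoint inner_mate
  th branch_diff cover branch_edge inner_edges (H := K4) (phi := phi)
  (col := fun e => (f e).1) (s := fun e => (f e).2)) => //.
- move=> e e' ce se; apply: val_inj; apply: (imset_inj phi_inj).
  rewrite -[LHS]fE -[RHS]fE -ce; case: se => ->; first by [].
  by rewrite tK setUC.
- move=> i t.
  (* The edge of [K4] for the thread of colour [i] at [t] is the preimage of its pair of ends. *)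
  have imE : phi @: [set a | phi a \in [set t; tau i t]] = [set t; tau i t].
    apply/setP=> u; apply/imsetP/idP => [[a]|ut]; first by rewrite inE => h ->.
    by have [a aE] := phi_surj u; exists a; rewrite // inE aE.
  have E2 : #|[set a | phi a \in [set t; tau i t]]| == 2.
    by rewrite -(card_imset _ phi_inj) imE cards2 [t == _]eq_sym (tau_neq th).
  pose e : edge K4 := Sub [set a | phi a \in [set t; tau i t]] E2.
  have eE : [set (f e).2; tau (f e).1 (f e).2] = [set t; tau i t].
    by rewrite fE.
  have /setP/(_ (f e).2) := eE; rewrite !inE eqxx => /esym/orP st.
  have /setP/(_ (tau (f e).1 (f e).2)) := eE; rewrite !inE eqxx orbT => /esym.
  have tn := tau_neq th (f e).1 (f e).2.
  case: st => /eqP st; rewrite st in tn *.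
    rewrite (negbTE tn) /= => /eqP /inj ci.
    by exists e => //; left.
  rewrite (negbTE tn) orbF => /eqP ti.
  exists e; last by right; rewrite st tK.
  by apply: (inj (tau i t)); rewrite ti tK.
Qed.

End Threads.

(** Two cycles arise if there is no branch vertex or if some inner vertex lies on no thread;
    otherwise the number of branch vertices decides between theta and [K4]. *)
Lemma triple_subdivision : K2_union_subdivision G.
Proof.
case: (set_0Vmem T) => [|[v0 v0T]]; first exact: no_branch_subdivision.
have [tau [p th]] := thread_system_exists mM mN inner_notin_branch
  unique_color_mate inner_mate.
pose t0 : branch := Sub v0 v0T.
case: (boolP [forall i, forall v, (v \in D i) ==>
    [exists t : branch, conn i (val t) v]]) => [/forallP cov|].
  have cover i v : v \in D i -> exists t : branch, conn i (val t) v.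
    by move=> vi; have /forallP/(_ v) := cov i; rewrite vi => /existsP.
  have [n iso] := triple_isomorphic.
  exists n, (induced (T :|: \bigcup_i D i)); split=> //; right.
  have := card_three_involutions (tauK mM mN inner_notin_branch inner_mate th)
    (tau_neq th) (coloring_constant th) t0.
  case=> [c2|[c4 inj]]; [left|right]; apply: embedded_odd_subdivision.
    exact: theta_subdivision th cover c2.
  exact: K4_subdivision th cover c4 inj.
rewrite negb_forall => /existsP[i]; rewrite negb_forall => /existsP[v].
rewrite negb_imply => /andP[vi /existsP nc].
exact: (uncovered_subdivision t0 vi nc).
Qed.

End Triple.

Theorem theorem2 (G : mgraph) (hG : minimally_matchable 3 G) :
  exists (n : nat) (S : mgraph),
    isomorphic G (dunion (copies n K2) S) /\
    (odd_subdivision (dunion two_cycle two_cycle) S \/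
     odd_subdivision theta S \/
     odd_subdivision K4 S).
Proof.
have [M tM] := matchable_triple (proj1 hG).
exact: triple_subdivision hG tM.
Qed.
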